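(* Let $G$ range over finite groups. Then $\gamma(L(G))$ tends to infinity as either the rank $r(G)$ of $G$ or the number $|\pi(G)|$ of prime divisors of $|G|$ tends to infinity. Explicitly: for every non-negative integer $k$ there exists an integer $N_k$ such that every finite group $G$ with $r(G)\geq N_k$ or $|\pi(G)|\geq N_k$ satisfies $\gamma(L(G))>k$.
   Context: For a finite group $G$, the subgroup graph $L(G)$ is the simple undirected graph whose vertices are the subgroups of $G$, two vertices $H_1,H_2$ being joined by an edge if and only if (up to exchanging them) $H_1<H_2$ and there is no subgroup $K$ of $G$ with $H_1<K<H_2$ (strict inclusions). The genus $\gamma(\Gamma)$ of a finite graph $\Gamma$ is the minimum $g\geq 0$ such that $\Gamma$ can be embedded (drawn with no two edges crossing) in the orientable surface $S_g$ of genus $g$. The rank $r(G)$ of a finite group $G$ is the minimal number $r$ such that every subgroup of $G$ can be generated by $r$ elements. $\pi(G)$ denotes the set of prime divisors of $|G|$. *)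

(* Defs.v *)
From HB Require Import structures.
From mathcomp Require Import all_boot all_order all_algebra all_fingroup.
From mathcomp Require Import all_classical all_reals all_analysis.
Set Implicit Arguments.
Unset Strict Implicit.
Unset Printing Implicit Defensive.
Import Order.TTheory GRing.Theory Num.Theory.
Import numFieldNormedType.Exports.

Local Open Scope classical_set_scope.
Local Open Scope ring_scope.

Record sgraph := SGraph {
  vertex :> finType;
  adj : rel vertex;
  adj_sym : symmetric adj;
  adj_irr : irreflexive adj }.

Section Embedding.
Variables (R : realType) (X : topologicalType) (S : set X) (Gamma : sgraph).

(* [arc u v] is only meaningful when [adj u v] holds; [arc u v] and [arc v u]
   are the two parametrizations, by [0, 1], of the one arc that represents the
   undirected edge {u, v}. *)
Record drawing (pt : Gamma -> X) (arc : Gamma -> Gamma -> R -> X) : Prop := {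
  drawing_pt_in : forall u, S (pt u);
  drawing_pt_inj : injective pt;
  drawing_arc_in : forall u v t, adj u v -> 0 <= t <= 1 -> S (arc u v t);
  drawing_arc_cont : forall u v, adj u v ->
    {within `[0, 1], continuous (arc u v)};
  drawing_arc_inj : forall u v s t, adj u v -> 0 <= s <= 1 -> 0 <= t <= 1 ->
    arc u v s = arc u v t -> s = t;
  drawing_arc0 : forall u v, adj u v -> arc u v 0 = pt u;
  drawing_arc1 : forall u v, adj u v -> arc u v 1 = pt v;
  drawing_arc_rev : forall u v t, adj u v -> 0 <= t <= 1 ->
    arc v u t = arc u v (1 - t);
  drawing_arc_pt : forall u v w t, adj u v -> 0 < t < 1 -> arc u v t <> pt w;
  drawing_arc_arc : forall u v x y s t, adj u v -> adj x y ->
    0 < s < 1 -> 0 < t < 1 -> arc u v s = arc x y t ->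
    (x = u /\ y = v) \/ (x = v /\ y = u) }.

Definition embeds : Prop := exists pt arc, drawing pt arc.

End Embedding.

Section Genus.
Variable R : realType.

(* The closed orientable surface of genus g, as a subspace of R^3.  The right
   hand side is >= 0 exactly on the disc of centre 0 and radius 3g+2 deprived of
   the g pairwise disjoint open discs of centres (3i, 0), 1 <= i <= g, and
   radius 1 (all contained in the interior of the big disc); it vanishes, to
   the first order, exactly on the g+1 boundary circles.  The surface is hence
   the smooth double of a disc with g holes, i.e. a sphere with g handles; for
   g = 0 it is the round sphere of radius 2. *)
Definition surface (g : nat) : set (R * R * R) :=
  [set p | let: (x, y, z) := p in
    z ^+ 2 = ((3 * g + 2)%:R ^+ 2 - x ^+ 2 - y ^+ 2) *
             \prod_(1 <= i < g.+1) ((x - (3 * i)%:R) ^+ 2 + y ^+ 2 - 1)].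

(* An infimum of natural numbers is a minimum; the value would be +oo if Gamma
   embedded in no surface, which does not happen for a finite graph. *)
Definition genus (Gamma : sgraph) : \bar R :=
  ereal_inf [set g%:R%:E | g in [set g : nat | embeds R (surface g) Gamma]].

End Genus.

Section SubgroupGraph.
Variables (gT : finGroupType) (G : {group gT}).

Definition subgroup_of := {H : {group gT} | H \subset G}.

Definition covered (H1 H2 : subgroup_of) : bool :=
  (val H1 \proper val H2) &&
  [forall K : subgroup_of,
     ~~ ((val H1 \proper val K) && (val K \proper val H2))].

Definition subgroup_adj : rel subgroup_of :=
  fun H1 H2 => covered H1 H2 || covered H2 H1.

Lemma subgroup_adj_sym : symmetric subgroup_adj.
Proof. by move=> H1 H2; rewrite /subgroup_adj orbC. Qed.

Lemma subgroup_adj_irr : irreflexive subgroup_adj.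
Proof. by move=> H; rewrite /subgroup_adj orbb /covered fintype.properxx. Qed.

Definition subgroup_graph : sgraph :=
  SGraph subgroup_adj_sym subgroup_adj_irr.

Definition subgroups_generated_by (r : nat) : bool :=
  [forall H : {group gT}, (H \subset G) ==>
     [exists A : {set gT}, (#|A| <= r)%N && (<<A>>%g == H)]].

Lemma ex_subgroups_generated_by : exists r, subgroups_generated_by r.
Proof.
exists #|G|; apply/forallP => H; apply/implyP => sHG.
by apply/existsP; exists (gval H); rewrite subset_leq_card //= genGid.
Qed.

(* Not the rank ['r(G)] of the library, which only considers elementary abelian
   subgroups. *)
Definition subgroup_rank : nat := ex_minn ex_subgroups_generated_by.

End SubgroupGraph.

(* Main.v *)
(* Both parameters force a large K_{3,n} minor.  Let A_1, ..., A_n be an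
   antichain of subgroups containing C, each with a maximal subgroup that does
   not contain C.  The subgroups properly above some A_i, those containing C and
   properly below some A_i, and those not containing C are three connected sets
   of vertices of L(G), and every A_i is adjacent to each of them.  An irredundant
   set of n + 1 elements yields such an antichain, which settles the rank.

   For the primes, consider the Sylow normalizers of G that are maximal among
   Sylow normalizers.  They form an antichain, and each of them is
   self-normalizing, so that the class of A has |G| / |A| members.  Fixing a
   maximal subgroup M_A of each A and counting the pairs (x, A) with x in A \ M_A
   bounds the number of classes, so one class dominates the normalizers of many
   Sylow subgroups.  Iterating inside that class gives Sylow subgroups P_1, ...,
   P_l for distinct primes with N(P_1) >= N(P_2) >= ..., and elements of P_i of
   order p_i are irredundant.

   A graph with a K_{3,n} minor, n > 2 * 64^g, does not embed in the surface of
   genus g.  Replace the edges by fine chains of points and count the crossings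
   of their projections to the (x, y)-plane mod 2.  Points of the surface that
   are far apart but have close projections lie on opposite sheets, hence the
   crossings of disjoint paths e and f are those of the upper part of e with f
   and those of the upper part of f with e.  Up to terms depending on one path
   and one end of the other, the former number is the sum over the holes of the
   passages of e through the fold around the hole, times the winding of f around
   the hole.  By pigeonhole there are three vertices whose edges have the same
   passages and windings, and summing over the 18 pairs of disjoint edges of the
   resulting K_{3,3} yields 1 = 0. *)

Require Import Defs.
From HB Require Import structures.
From Stdlib Require Import Btauto.
From mathcomp Require Import all_boot all_order all_algebra all_fingroup all_solvable.
From mathcomp Require Import all_classical all_reals all_analysis.
From mathcomp Require Import ring lra zify.
Import Order.TTheory GRing.Theory Num.Theory.
Import numFieldNormedType.Exports.
Set Implicit Arguments.
Unset Strict Implicit.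
Unset Printing Implicit Defensive.

Local Open Scope ring_scope.

(** * Sums mod 2 along chains *)

Fixpoint xsum (T : Type) (c : T -> T -> bool) (x : T) (l : seq T) : bool :=
  if l is y :: l' then c x y (+) xsum c y l' else false.

Fixpoint chain (T : Type) (r : T -> T -> Prop) (x : T) (l : seq T) : Prop :=
  if l is y :: l' then r x y /\ chain r y l' else True.

Lemma eq_xsum (T : Type) (r : T -> T -> Prop) (c d : T -> T -> bool) x l :
  chain r x l -> (forall a b, r a b -> c a b = d a b) ->
  xsum c x l = xsum d x l.
Proof.
move=> + cd; elim: l x => //= y l IHl x [rxy /IHl ->].
by rewrite cd.
Qed.

Lemma xsumD (T : Type) (c d : T -> T -> bool) x l :
  xsum (fun a b => c a b (+) d a b) x l = xsum c x l (+) xsum d x l.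
Proof. by elim: l x => //= y l IHl x; rewrite IHl addbACA. Qed.

Lemma xsum_andl (T : Type) (b : bool) (c : T -> T -> bool) x l :
  xsum (fun a a' => b && c a a') x l = b && xsum c x l.
Proof. by elim: l x => //= [|y l IHl] x; rewrite ?andbF // IHl andb_addr. Qed.

Lemma xsum_tele (T : Type) (u : T -> bool) x l :
  xsum (fun a b => u a (+) u b) x l = u x (+) u (last x l).
Proof.
elim: l x => [|y l IHl] x /=; first by rewrite addbb.
by rewrite IHl addbA addbK.
Qed.

Lemma xsum_exchange (S T : Type) (c : S -> S -> T -> T -> bool) x l y m :
  xsum (fun a a' => xsum (c a a') y m) x l =
  xsum (fun b b' => xsum (fun a a' => c a a' b b') x l) y m.
Proof.
elim: l x => [|x' l IHl] x /=; last by rewrite IHl xsumD.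
by elim: m y => [|y' m IHm] y /=; rewrite -?IHm.
Qed.

Lemma chain_sub (T : Type) (r r' : T -> T -> Prop) x l :
  (forall a b, r a b -> r' a b) -> chain r x l -> chain r' x l.
Proof. by move=> rr'; elim: l x => //= y l IHl x [/rr' ? /IHl]. Qed.

Lemma chain_cat (T : Type) (r : T -> T -> Prop) x l l' :
  chain r x l -> chain r (last x l) l' -> chain r x (l ++ l').
Proof. by elim: l x => //= y l IHl x [rxy cl] cl'; split=> //; apply: IHl. Qed.

(* Sum over the product of two chains of the coboundary of a 1-cochain given by
   its values [A] on the steps in the first factor and [B] in the second. *)
Section Rectangle.
Variables (T : Type) (A B : T -> T -> T -> bool).

Definition rect p p' q q' := A p p' q (+) A p p' q' (+) B q q' p (+) B q q' p'.

Lemma xsum_rect_row p p' y m :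
  xsum (rect p p') y m = A p p' y (+) A p p' (last y m)
    (+) xsum (fun q q' => B q q' p) y m (+) xsum (fun q q' => B q q' p') y m.
Proof. by rewrite /rect 2!xsumD xsum_tele. Qed.

(** Discrete Stokes formula: terms on interior edges occur twice and cancel, so only the four sides
    remain. *)
Lemma xsum_rect x l y m :
  xsum (fun p p' => xsum (rect p p') y m) x l =
    xsum (fun p p' => A p p' y) x l (+) xsum (fun p p' => A p p' (last y m)) x l
    (+) xsum (fun q q' => B q q' x) y m (+) xsum (fun q q' => B q q' (last x l)) y m.
Proof.
elim: l x => [|x' l IHl] x /=; first by rewrite addbb.
rewrite xsum_rect_row IHl.
move: (A _ _ _) (A _ _ _) (xsum _ _ _) (xsum _ _ _) (xsum _ _ _) (xsum _ _ _).
by move: (xsum _ _ _) => [] [] [] [] [] [] [].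
Qed.

(** Summation by parts: besides the boundary terms, each step on which the weight [t] changes
    contributes a term, taken at its second end [p']. *)
Lemma xsum_rect_weighted (t : T -> bool) x l y m :
  let U p := xsum (fun q q' => B q q' p) y m in
  xsum (fun p p' => t p && xsum (rect p p') y m) x l =
    xsum (fun p p' => t p && A p p' y) x l
    (+) xsum (fun p p' => t p && A p p' (last y m)) x l
    (+) (t x && U x) (+) (t (last x l) && U (last x l))
    (+) xsum (fun p p' => (t p (+) t p') && U p') x l.
Proof.
move=> U; elim: l x => [|x' l IHl] x /=; first by rewrite addbb.
rewrite xsum_rect_row IHl -/(U x) -/(U x').
move: (U (last _ _)) (t (last _ _)) (A x x' y) (A x x' (last y m)).
move: (U x) (U x') (t x) (t x').
move: (xsum _ _ _) (xsum _ _ _) (xsum _ _ _).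
by do 11 case.
Qed.

End Rectangle.

(** * Crossings in the plane *)

Section Plane.
Variable R : realType.
Local Notation pt := (R * R * R)%type.
Implicit Types p q o : pt.

Definition px p := p.1.1.
Definition py p := p.1.2.
Definition pz p := p.2.

Definition nearby d p q :=
  [/\ `|px p - px q| < d, `|py p - py q| < d & `|pz p - pz q| < d].
Definition planefar d p q := (d <= `|px p - px q|) || (d <= `|py p - py q|).

(** [pz] takes part in the order so that distinct points with the same projection are still
    comparable. *)
Definition lexlt p q := (px p < px q) || ((px p == px q) &&
  ((py p < py q) || ((py p == py q) && (pz p < pz q)))).

Lemma lexlt_total p q : p != q -> lexlt q p = ~~ lexlt p q.
Proof.
case: p q => [[x y] z] [[x' y'] z']; rewrite /lexlt /px /py /pz /= !xpair_eqE.
by case: (ltgtP x x') => //= _; case: (ltgtP y y') => //= _; case: ltgtP.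
Qed.

Lemma lexlt_px p q : px p < px q -> lexlt p q.
Proof. by rewrite /lexlt => ->. Qed.

Lemma lexlt_px_gt p q : px q < px p -> lexlt p q = false.
Proof. by rewrite /lexlt; case: ltgtP. Qed.

(* Crossings mod 2 of the step [p p'] with the upward vertical ray from [q]; then
   of the step [q q'] with the downward vertical ray from [p].  Breaking ties
   lexicographically makes the two notions differ by a coboundary. *)
Definition upcross p p' q := (lexlt p q (+) lexlt p' q) && (py q < py p).
Definition downcross q q' p := upcross q q' p (+) lexlt p q (+) lexlt p q'.

Definition cross := rect upcross downcross.

Lemma planefar_neq d p q : 0 < d -> planefar d p q -> p != q.
Proof.
move=> d0; apply: contraTneq => ->.
by rewrite /planefar !subrr normr0 leNgt d0.
Qed.

(** If the steps are apart in [px], all comparisons by [lexlt] agree; if they are apart in [py], all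
    comparisons of heights in the plane agree. In either case the four terms cancel. *)
Lemma cross_far d p p' q q' : 0 < d -> nearby d p p' -> nearby d q q' ->
  planefar (3 * d) p q -> cross p p' q q' = false.
Proof.
move=> d0 [xp yp zp] [xq yq zq] pq.
have tri a b a' b' : 3 * d <= `|a - b| -> `|a - a'| < d -> `|b - b'| < d ->
    [/\ d <= `|a - b'|, d <= `|a' - b| & d <= `|a' - b'|].
  move=> ab aa bb; have := (ler_distD a' a b, ler_distD b' a b, ler_distD b' a' b).
  rewrite (distrC b' b) => -[[]]; split; lra.
have [F1 F2 F3] : [/\ planefar d p q', planefar d p' q & planefar d p' q'].
  rewrite /planefar; case/orP: pq => [/tri/(_ xp xq)|/tri/(_ yp yq)] [-> -> ->] //.
  by rewrite !orbT.
have F0 : planefar d p q.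
  by move: pq; rewrite /planefar => /orP [] h; apply/orP; [left|right];
    apply: le_trans h; lra.
have S0 := lexlt_total (planefar_neq d0 F0).
have S1 := lexlt_total (planefar_neq d0 F1).
have S2 := lexlt_total (planefar_neq d0 F2).
have S3 := lexlt_total (planefar_neq d0 F3).
rewrite /cross /rect /downcross /upcross S0 S1 S2 S3.
move: pq xp yp xq yq; rewrite /planefar !ltr_norml.
case/orP; rewrite ler_normr => /orP [] h /andP [? ?] /andP [? ?]
    /andP [? ?] /andP [? ?].
- by rewrite !lexlt_px_gt //; lra.
- by rewrite !lexlt_px //; lra.
  have -> : py q < py p by lra. have -> : py q' < py p by lra.
  have -> : py p < py q = false by apply/negbTE; rewrite -leNgt; lra.
  have -> : py p' < py q = false by apply/negbTE; rewrite -leNgt; lra.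
  by do 4 case: lexlt.
- have -> : py q < py p = false by apply/negbTE; rewrite -leNgt; lra.
  have -> : py q' < py p = false by apply/negbTE; rewrite -leNgt; lra.
  have -> : py p < py q by lra.
  have -> : py p' < py q by lra.
  by do 4 case: lexlt.
Qed.

Lemma cross_sym p p' q q' : p != q -> p != q' -> p' != q -> p' != q' ->
  cross p p' q q' = cross q q' p p'.
Proof.
move=> /lexlt_total S0 /lexlt_total S1 /lexlt_total S2 /lexlt_total S3.
rewrite /cross /rect /downcross /upcross S0 S1 S2 S3.
by do 4 case: lexlt; do 4 case: (_ < _).
Qed.

End Plane.

Section Homotopy.
Variable R : realType.
Local Notation pt := (R * R * R)%type.
Implicit Types (p q o u v : pt) (d : R).

Definition seg u v (t : R) : pt :=
  (px u + t * (px v - px u), py u + t * (py v - py u), pz u + t * (pz v - pz u)).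

Lemma seg0 u v : seg u v 0 = u.
Proof. by case: u => [[? ?] ?]; rewrite /seg /px /py /pz /= !mul0r !addr0. Qed.

Lemma seg1 u v : seg u v 1 = v.
Proof. by case: v => [[? ?] ?]; rewrite /seg /px /py /pz /= !mul1r !subrKC. Qed.

Lemma chain_subdivision (T : Type) (r : T -> T -> Prop) (f : nat -> T) n i :
  (forall j, (i <= j < i + n)%N -> r (f j) (f j.+1)) ->
  chain r (f i) [seq f j | j <- iota i.+1 n] /\
  last (f i) [seq f j | j <- iota i.+1 n] = f (i + n)%N.
Proof.
elim: n i => [|n IHn] i rf /=; first by rewrite addn0.
have [|? ->] := IHn i.+1; last by rewrite addSnnS; split=> //; split=> //; apply: rf; lia.
by move=> j ij; apply: rf; lia.
Qed.

(* As [seg u v] stays away from the steps [q q'], moving the origin of the ray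
   from [u] to [v] changes the number of crossings by a coboundary. *)
Lemma downcross_homotopy d u v : 0 < d -> exists G : pt -> bool,
  forall q q', nearby d q q' ->
  (forall t : R, 0 <= t <= 1 -> planefar (3 * d) (seg u v t) q) ->
  downcross q q' u (+) downcross q q' v = G q (+) G q'.
Proof.
move=> d0.
(* [c] bounds the displacement in each coordinate, so that [n.+1 > c / d] equal pieces have [nearby]
   ends. *)
pose c : R := `|px v - px u| + `|py v - py u| + `|pz v - pz u|.
have c0 : 0 <= c by rewrite !addr_ge0.
have [n cn] : exists n : nat, c / d < n.+1%:R.
  exists (Num.bound (c / d)); apply: lt_trans (archi_boundP _) _.
    by rewrite divr_ge0 // ltW.
  by rewrite ltr_nat.
pose f j := seg u v (j%:R / n.+1%:R).
have f0 : f 0%N = u by rewrite /f mul0r seg0.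
have fn : f (0 + n.+1)%N = v by rewrite /f add0n divff ?seg1 ?pnatr_eq0.
pose r a b := nearby d a b /\ exists2 t : R, 0 <= t <= 1 & a = seg u v t.
have [|fc fl] := @chain_subdivision _ r f n.+1 0.
  move=> j /andP [_ jn]; split; last first.
    exists (j%:R / n.+1%:R) => //.
    by rewrite divr_ge0 //= ler_pdivrMr ?ltr0n // mul1r ler_nat ltnW.
  have E (a b : R) : `|b - a| <= c ->
      `|a + j%:R / n.+1%:R * (b - a) - (a + j.+1%:R / n.+1%:R * (b - a))| < d.
    move=> abc; rewrite -(natr1 j).
    have N0 : n.+1%:R != 0 :> R by rewrite pnatr_eq0.
    have -> : a + j%:R / n.+1%:R * (b - a) - (a + (j%:R + 1) / n.+1%:R * (b - a))
       = - ((b - a) / n.+1%:R) by move: (n.+1%:R) N0 => N N0; field.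
    rewrite normrN normrM normfV (ger0_norm (ler0n _ _)) ltr_pdivrMr ?ltr0n //.
    by apply: le_lt_trans abc _; rewrite mulrC -ltr_pdivrMr.
  by split; apply: E; rewrite /c ?lerDr ?addr_ge0 // -addrA ?lerDl ?addr_ge0 //
     addrCA lerDl addr_ge0.
pose l := [seq f j | j <- iota 1 n.+1].
(* The primitive counts the crossings of the subdivided segment with the upward ray from [q]. On the
   product of the segment with the step from [q] to [q'] every [cross] vanishes, and [xsum_rect]
   leaves the coboundary. *)
exists (fun q => xsum (fun p p' => upcross p p' q) u l) => q q' qq' fq.
have ul : last u l = v by rewrite -f0 -fn -fl.
have cl : chain r u l by rewrite -f0.
have := xsum_rect (@upcross R) (@downcross R) u l q [:: q'].
rewrite ul (eq_xsum (d := fun _ _ => false) cl) => [|a b].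
  have -> : xsum (fun _ _ => false) u l = false by elim: (l) (u) => //= ? ? ->.
  move: l cl ul => l _ _; rewrite [last q _]/= [xsum (fun q q0 => downcross q q0 u) _ _]/=.
  rewrite [xsum (fun q q0 => downcross q q0 v) _ _]/= !addbF.
  by move: (xsum _ _ _) (xsum _ _ _) (downcross _ _ _) (downcross _ _ _) => [] [] [] [].
case=> ab [t t01 at_]; rewrite /= addbF; apply: (cross_far d0 ab) => //.
by rewrite at_; apply: fq.
Qed.

End Homotopy.

(** * The surface and its folds *)

Section Surface.
Variable R : realType.
Local Notation pt := (R * R * R)%type.
Implicit Types (p q o u v : pt) (x y : R).

Definition outer_factor g x y : R := (3 * g + 2)%:R ^+ 2 - x ^+ 2 - y ^+ 2.
Definition hole_factor (i : nat) x y : R := (x - (3 * i)%:R) ^+ 2 + y ^+ 2 - 1.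
Definition height2 g x y : R :=
  outer_factor g x y * \prod_(1 <= i < g.+1) hole_factor i x y.

Lemma surfaceE g p : @surface R g p <-> pz p ^+ 2 = height2 g (px p) (py p).
Proof. by case: p => [[x y] z]. Qed.

Lemma in_disc_lt (a r x y : R) : 0 <= a -> a + 1 < r ->
  (x - a) ^+ 2 + y ^+ 2 <= 1 -> x ^+ 2 + y ^+ 2 < r ^+ 2.
Proof.
move=> a0 ar xy; have xa : x <= a + 1 by nra.
by nra.
Qed.

(** A nonnegative product could a priori have two negative factors. But the holes are disjoint and
    lie inside the big disc, so that a negative factor makes all others positive. *)
Lemma surface_region g p : @surface R g p ->
  0 <= outer_factor g (px p) (py p) /\
  forall i, (0 < i <= g)%N -> 0 <= hole_factor i (px p) (py p).
Proof.
move/surfaceE; move: (px p) (py p) => x y h.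
have h0 : 0 <= height2 g x y by rewrite -h sqr_ge0.
have ig i : (0 < i <= g)%N -> hole_factor i x y <= 0 -> 0 < outer_factor g x y.
  move=> /andP [i0 ig] hi; rewrite /outer_factor -addrA -opprD subr_gt0.
  apply: (@in_disc_lt (3 * i)%:R); rewrite ?ler0n //.
    by rewrite natr1 ltr_nat; lia.
  by move: hi; rewrite /hole_factor subr_le0.
have holes i : (0 < i <= g)%N -> 0 <= hole_factor i x y.
  move=> i1g; rewrite leNgt; apply/negP => hi.
  suff : height2 g x y < 0 by rewrite ltNge h0.
  rewrite /height2 pmulr_rlt0 ?(ig i) 1?ltW //.
  rewrite (bigD1_seq i) ?mem_index_iota ?iota_uniq //=.
  rewrite nmulr_rlt0 // big_seq_cond; apply: prodr_gt0 => j.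
  rewrite mem_index_iota => /andP [/andP [j0 jg] ji].
  rewrite /hole_factor in hi *; have [ij|ij] : (i.+1 <= j \/ j.+1 <= i)%N by lia.
    have : (3 * i)%:R + 3 <= (3 * j)%:R :> R by rewrite -natrD ler_nat; lia.
    move: hi; move: (3 * i)%:R (3 * j)%:R => a b hi ab; have xa : x < a + 1 by nra.
    by nra.
  have : (3 * j)%:R + 3 <= (3 * i)%:R :> R by rewrite -natrD ler_nat; lia.
  move: hi; move: (3 * i)%:R (3 * j)%:R => a b hi ab; have xa : a - 1 < x by nra.
  by nra.
split=> //; rewrite leNgt; apply/negP => ho.
suff : height2 g x y < 0 by rewrite ltNge h0.
rewrite /height2 nmulr_rlt0 // big_seq_cond; apply: prodr_gt0 => i.
rewrite mem_index_iota andbT => /andP [i0 ig']; rewrite ltNge; apply/negP => hi.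
by have := lt_trans ho (ig i _ hi); rewrite i0 -ltnS ig' ltxx => /(_ isT).
Qed.

(** One constant serves as bound and as Lipschitz constant, which makes the property stable under
    products. *)
Definition box_lipschitz (r : R) (f : R -> R -> R) := exists2 c : R, 0 <= c &
  forall x y x' y', `|x| <= r -> `|y| <= r -> `|x'| <= r -> `|y'| <= r ->
  `|f x y| <= c /\ `|f x y - f x' y'| <= c * (`|x - x'| + `|y - y'|).

Lemma box_lipschitzM r f h : box_lipschitz r f -> box_lipschitz r h ->
  box_lipschitz r (fun x y => f x y * h x y).
Proof.
case=> c c0 fc [d d0 hd]; exists (2 * c * d); first by rewrite !mulr_ge0.
move=> x y x' y' hx hy hx' hy'.
have [fx fl] := fc _ _ _ _ hx hy hx' hy'; have [hx1 hl] := hd _ _ _ _ hx hy hx' hy'.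
have [hx2 _] := hd _ _ _ _ hx' hy' hx hy.
have fh : `|f x y| * `|h x y| <= c * d by apply: ler_pM.
split; first by rewrite normrM; nra.
have -> : f x y * h x y - f x' y' * h x' y' =
  f x y * (h x y - h x' y') + (f x y - f x' y') * h x' y' by ring.
apply: le_trans (ler_normD _ _) _; rewrite !normrM.
have := ler_pM (normr_ge0 _) (normr_ge0 _) fx hl.
have := ler_pM (normr_ge0 _) (normr_ge0 _) fl hx2.
by move=> H1 H2; apply: le_trans (lerD H2 H1) _; nra.
Qed.

Lemma box_lipschitzD r f h : box_lipschitz r f -> box_lipschitz r h ->
  box_lipschitz r (fun x y => f x y + h x y).
Proof.
case=> c c0 fc [d d0 hd]; exists (c + d); first by rewrite addr_ge0.
move=> x y x' y' hx hy hx' hy'.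
have [fx fl] := fc _ _ _ _ hx hy hx' hy'; have [hx1 hl] := hd _ _ _ _ hx hy hx' hy'.
split; first by apply: le_trans (ler_normD _ _) _; rewrite lerD.
by rewrite opprD addrACA mulrDl; apply: le_trans (ler_normD _ _) _; rewrite lerD.
Qed.

Lemma box_lipschitz_cst r a : box_lipschitz r (fun _ _ => a).
Proof.
exists `|a| => // x y x' y' _ _ _ _; split=> //.
by rewrite subrr normr0 mulr_ge0 ?addr_ge0.
Qed.

Lemma box_lipschitz_x r : box_lipschitz r (fun x _ => x).
Proof.
exists (`|r| + 1); first by rewrite addr_ge0.
move=> x y x' y' hx _ _ _; split.
  by apply: le_trans hx _; apply: le_trans (ler_norm _) _; rewrite lerDl.
by rewrite -[leLHS]mul1r ler_pM ?lerDl ?lerDr.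
Qed.

Lemma box_lipschitz_y r : box_lipschitz r (fun _ y => y).
Proof.
exists (`|r| + 1); first by rewrite addr_ge0.
move=> x y x' y' _ hx _ _; split.
  by apply: le_trans hx _; apply: le_trans (ler_norm _) _; rewrite lerDl.
by rewrite -[leLHS]mul1r ler_pM ?lerDl ?lerDr.
Qed.

Lemma box_lipschitz_height2 r g : box_lipschitz r (height2 g).
Proof.
pose x2 := box_lipschitzM (box_lipschitz_x r) (box_lipschitz_x r).
pose y2 := box_lipschitzM (box_lipschitz_y r) (box_lipschitz_y r).
have N f : box_lipschitz r f -> box_lipschitz r (fun x y => - f x y).
  move=> lf; have := box_lipschitzM (box_lipschitz_cst r (-1)) lf.
  by under eq_fun do under eq_fun do rewrite mulN1r.
apply: box_lipschitzM.
  apply: box_lipschitzD; last exact: N y2.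
  by apply: box_lipschitzD; [apply: box_lipschitz_cst|apply: N x2].
elim: (index_iota 1 g.+1) => [|i s IHs].
  under eq_fun do under eq_fun do rewrite big_nil.
  exact: box_lipschitz_cst.
under eq_fun do under eq_fun do rewrite big_cons.
apply: box_lipschitzM => //.
have xi := box_lipschitzD (box_lipschitz_x r) (box_lipschitz_cst r (- (3 * i)%:R)).
have := box_lipschitzD (box_lipschitzD (box_lipschitzM xi xi) y2).
by move=> /(_ _ (box_lipschitz_cst r (-1))).
Qed.

(** If all [g + 1] factors are at least [k], their product is at least [k ^+ g.+1]. Points of the
    surface of small height thus project close to a boundary circle. *)
Lemma height2_small g k : 0 < k -> exists2 m : R, 0 < m & forall x y,
  height2 g x y < m -> outer_factor g x y < k \/
  exists2 i, (0 < i <= g)%N & hole_factor i x y < k.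
Proof.
move=> k0; exists (k * \prod_(1 <= i < g.+1) k).
  by rewrite mulr_gt0 // prodr_gt0.
move=> x y; have [|ok] := ltP (outer_factor g x y) k; first by left.
have [/hasP [i]|/hasPn noi] :=
  boolP (has (fun i => hole_factor i x y < k) (index_iota 1 g.+1)).
  by rewrite mem_index_iota ltnS => ? ?; right; exists i.
rewrite ltNge => /negP []; apply: ler_pM => //.
- exact: ltW.
- by rewrite prodr_ge0 // => *; exact: ltW.
rewrite big_seq [leRHS]big_seq; apply: ler_prod => i /noi; rewrite -leNgt => ->.
by rewrite ltW.
Qed.

End Surface.

Section Fold.
Variables (R : realType) (g : nat).
Local Notation pt := (R * R * R)%type.
Implicit Types (p q o u v : pt) (x y d e k : R).

Definition far e p q :=
  [|| e <= `|px p - px q|, e <= `|py p - py q| | e <= `|pz p - pz q|].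

Definition hole_center (i : nat) : pt := ((3 * i)%:R, 0, 0).

Definition top p := 0 < pz p.

Lemma planefar_sqr d p q : 0 <= d ->
  2 * d ^+ 2 <= (px p - px q) ^+ 2 + (py p - py q) ^+ 2 -> planefar d p q.
Proof.
move=> d0 h; rewrite /planefar !leNgt -negb_and; apply/negP => /andP [].
move: h; move: (px p - px q) (py p - py q) => x y h.
by rewrite !ltr_norml => /andP [? ?] /andP [? ?]; nra.
Qed.

Lemma sqr_planefar d p q : 0 <= d -> planefar d p q ->
  d ^+ 2 <= (px p - px q) ^+ 2 + (py p - py q) ^+ 2.
Proof.
move=> d0; rewrite /planefar; move: (px p - px q) (py p - py q) => x y.
by case/orP; rewrite ler_normr => /orP [] ?; nra.
Qed.

Lemma surface_box p : @surface R g p ->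
  `|px p| <= (3 * g + 2)%:R /\ `|py p| <= (3 * g + 2)%:R.
Proof.
case/surface_region; rewrite /outer_factor => h _.
have := ler0n R (3 * g + 2)%N.
by split; rewrite ler_norml; apply/andP; split; nra.
Qed.

Lemma surface_height_lipschitz : exists2 c : R, 0 <= c & forall p q,
  @surface R g p -> @surface R g q ->
  `|pz p ^+ 2 - pz q ^+ 2| <= c * (`|px p - px q| + `|py p - py q|).
Proof.
have [c c0 cl] := @box_lipschitz_height2 R (3 * g + 2)%:R g; exists c => // p q Sp Sq.
have [[? ?] [? ?]] := (surface_box Sp, surface_box Sq).
rewrite (surfaceE g p).1 // (surfaceE g q).1 //.
by have [|||| _] := cl (px p) (py p) (px q) (py q).
Qed.

(** Steps that cross have close projections, hence almost equal squared heights by the Lipschitz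
    bound. If they are far apart in space, their heights must have opposite signs. *)
Lemma cross_top e : 0 < e -> exists2 d0, 0 < d0 & forall d, 0 < d <= d0 ->
  forall p p' q q', @surface R g p -> @surface R g q ->
  nearby d p p' -> nearby d q q' -> far e p q ->
  cross p p' q q' -> top p (+) top q.
Proof.
move=> e0; have [c c0 cl] := surface_height_lipschitz.
have K0 : 0 < 16 * (c + 1) by lra.
exists (Num.min (e / 4) (e ^+ 2 / (16 * (c + 1)))).
  by rewrite lt_min !divr_gt0 ?exprn_gt0.
move=> d /andP [d0]; rewrite le_min !ler_pdivlMr // => /andP [de dc].
move=> p p' q q' Sp Sq pp qq pq; apply: contraLR => tt.
rewrite (cross_far d0 pp qq) // /planefar; have hc := cl p q Sp Sq.
rewrite !leNgt -negb_and; apply/negP => /andP [hx hy].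
move: pq; rewrite /far !leNgt.
have -> : `|px p - px q| < e by apply: lt_le_trans hx _; lra.
have -> : `|py p - py q| < e by apply: lt_le_trans hy _; lra.
rewrite /= -leNgt => hz.
have : e ^+ 2 <= `|pz p ^+ 2 - pz q ^+ 2|.
  have -> : pz p ^+ 2 - pz q ^+ 2 = (pz p - pz q) * (pz p + pz q) by ring.
  rewrite normrM; apply: ler_pM => //; [exact: ltW|exact: ltW|].
  (* For heights on the same side of 0, the difference is at most the sum in absolute value. *)
  apply: le_trans hz _; move: tt; rewrite /top.
  by case: (ltrP 0 (pz p)) => ?; case: (ltrP 0 (pz q)) => ? // _;
    case: (ler0P (pz p - pz q)) => ?; case: (ler0P (pz p + pz q)) => ?; lra.
rewrite leNgt => /negP []; apply: le_lt_trans hc _.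
have cd : 0 <= c * d by rewrite mulr_ge0 // ltW.
apply: (@le_lt_trans _ _ (c * (6 * d))).
  by apply: ler_wpM2l => //; lra.
by nra.
Qed.

(** Near a fold the opposite sheet is close too: with [|pz p| < e / 4] and heights [e] apart, the
    squared heights differ by at least [e ^+ 2 / 2], which close projections exclude. *)
Lemma far_planefar e : 0 < e -> exists2 e', 0 < e' <= 1 / 2 &
  exists2 d0, 0 < d0 & forall p q, @surface R g p -> @surface R g q ->
  `|pz p| < d0 -> far e p q -> planefar e' p q.
Proof.
move=> e0; have [c c0 cl] := surface_height_lipschitz.
have K0 : 0 < 16 * (c + 1) by lra.
pose e' := Num.min (Num.min e (1 / 2)) (e ^+ 2 / (16 * (c + 1))).
have e'0 : 0 < e' by rewrite !lt_min e0 !divr_gt0 ?exprn_gt0.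
have : e' <= e' by []; rewrite {2}/e' !le_min => /andP [/andP [e1 e2]].
rewrite ler_pdivlMr // => e3.
exists e'; first by rewrite e'0 e2.
exists (e / 4) => [|p q Sp Sq zp pq]; first by rewrite divr_gt0.
have hc := cl p q Sp Sq; rewrite /planefar !leNgt -negb_and; apply/negP => /andP [hx hy].
move: pq; rewrite /far !leNgt (lt_le_trans hx e1) (lt_le_trans hy e1) /= -leNgt => hz.
have hxy : `|pz p ^+ 2 - pz q ^+ 2| <= c * (2 * e').
  by apply: le_trans hc _; apply: ler_wpM2l => //; lra.
have zp2 : pz p ^+ 2 < (e / 4) ^+ 2.
  by move: zp; rewrite ltr_norml => /andP [? ?]; nra.
have zq2 : (3 / 4 * e) ^+ 2 <= pz q ^+ 2.
  by move: zp hz; rewrite ltr_norml ler_normr => /andP [? ?] /orP [] ?; nra.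
by move: hxy; rewrite ler_norml => /andP [? ?]; nra.
Qed.

Lemma radial_sqr_dist (l a b x y : R) :
  (l * a - x) ^+ 2 + (l * b - y) ^+ 2 =
  l * ((a - x) ^+ 2 + (b - y) ^+ 2) +
  (1 - l) * ((x ^+ 2 + y ^+ 2) - l * (a ^+ 2 + b ^+ 2)).
Proof. by ring. Qed.

(** In [radial_sqr_dist], the first term suffices for [l >= 1 / 2], up to a small loss in the
    second; for smaller [l] the second term suffices, since [e <= 1 / 2]. *)
Lemma radial_inward e l a b x y : 0 < e <= 1 / 2 -> 0 <= l <= 1 ->
  e ^+ 2 <= (a - x) ^+ 2 + (b - y) ^+ 2 ->
  1 <= x ^+ 2 + y ^+ 2 -> a ^+ 2 + b ^+ 2 <= 1 + e ^+ 2 / 8 ->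
  3 / 8 * e ^+ 2 <= (l * a - x) ^+ 2 + (l * b - y) ^+ 2.
Proof.
move=> /andP [e0 e1] /andP [l0 l1] h1 h2 h3; rewrite radial_sqr_dist.
move: ((a - x) ^+ 2 + (b - y) ^+ 2) h1 (x ^+ 2 + y ^+ 2) h2 (a ^+ 2 + b ^+ 2) h3.
move=> D h1 U h2 P h3.
set E := e ^+ 2 in h1 h3 *.
have E0 : 0 < E by rewrite exprn_gt0.
have E1 : E <= 1 / 4 by rewrite /E; nra.
have h4 : (1 - l) * (1 - l * (1 + E / 8)) <= (1 - l) * (U - l * P).
  apply: ler_wpM2l; first lra.
  by have := ler_wpM2l l0 h3; lra.
have h5 := ler_wpM2l l0 h1.
have [l2|l2] := lerP (1 / 2) l; nra.
Qed.

(** As [l <= 2], the second term of [radial_sqr_dist] loses at most [e ^+ 2 / 4]. *)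
Lemma radial_outward (r e l a b x y : R) : 1 <= l <= 2 ->
  e ^+ 2 <= (a - x) ^+ 2 + (b - y) ^+ 2 ->
  x ^+ 2 + y ^+ 2 <= r ^+ 2 -> r ^+ 2 - e ^+ 2 / 8 <= a ^+ 2 + b ^+ 2 ->
  3 / 8 * e ^+ 2 <= (l * a - x) ^+ 2 + (l * b - y) ^+ 2.
Proof.
move=> /andP [l1 l2] h1 h2 h3; rewrite radial_sqr_dist.
move: ((a - x) ^+ 2 + (b - y) ^+ 2) h1 (x ^+ 2 + y ^+ 2) h2 (a ^+ 2 + b ^+ 2) h3.
move=> D h1 U h2 P h3.
set E := e ^+ 2 in h1 h3 *; set r2 := r ^+ 2 in h2 h3.
have E0 : 0 <= E by rewrite sqr_ge0.
have r0 : 0 <= r2 by rewrite sqr_ge0.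
have -> : (1 - l) * (U - l * P) = (l - 1) * (l * P - U) by ring.
have h4 : (l - 1) * (l * (r2 - E / 8) - r2) <= (l - 1) * (l * P - U).
  apply: ler_wpM2l; first lra.
  have l0 : 0 <= l by lra.
  by have := ler_wpM2l l0 h3; lra.
have h5 : l * E <= l * D by apply: ler_wpM2l => //; lra.
have h6 : 0 <= (l - 1) * ((l - 1) * r2) by rewrite mulr_ge0 1?mulr_ge0 ?subr_ge0.
have h7 : (l - 1) * l * E <= 2 * E by apply: ler_wpM2r => //; nra.
have h8 : 1 * E <= l * E by apply: ler_wpM2r.
lra.
Qed.

(** A point outside the square has winding number 0 around it; the primitive depends on the side on
    which the point lies. *)
Lemma downcross_outside r u : r < `|px u| \/ r < `|py u| ->
  exists G : pt -> bool, forall q q', `|px q| <= r -> `|py q| <= r ->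
  `|px q'| <= r -> `|py q'| <= r -> downcross q q' u = G q (+) G q'.
Proof.
move=> ru; exists (if r < px u then xpred0 else if px u < - r then xpred0
  else if r < py u then fun q => lexlt u q else fun q => lexlt u q (+) lexlt q u).
move=> q q'.
rewrite !ler_norml => /andP [? ?] /andP [? ?] /andP [? ?] /andP [? ?].
rewrite /downcross /upcross; case: (ltrP r (px u)) => h1.
  have ? : px q < px u by lra. have ? : px q' < px u by lra.
  by rewrite !(@lexlt_px _ _ u) ?(@lexlt_px_gt _ u).
case: (ltrP (px u) (- r)) => h2.
  have ? : px u < px q by lra. have ? : px u < px q' by lra.
  by rewrite !(@lexlt_px_gt _ _ u) ?(@lexlt_px _ u).
case: (ltrP r (py u)) => h3.
  have -> : py u < py q = false by apply/negbTE; rewrite -leNgt; lra.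
  by rewrite andbF.
have -> : py u < py q.
  by move: ru; rewrite !ltr_normr => -[/orP|/orP] [] ?; lra.
by rewrite andbT; do 4 case: lexlt.
Qed.

(* Near a fold the origin [p] of the ray can be pushed along a radius, to the
   centre of the hole or, on the outer circle, out of the surface, without meeting
   the projection of the rest of the surface. *)
Lemma fold_downcross e : 0 < e -> exists2 d0, 0 < d0 & forall d, 0 < d <= d0 ->
  forall p, @surface R g p -> `|pz p| < d ->
  exists (k : option 'I_g) (G : pt -> bool), forall q q',
  @surface R g q -> @surface R g q' -> nearby d q q' -> far e p q ->
  downcross q q' p (+)
    (if k is Some i then downcross q q' (hole_center i.+1) else false)
  = G q (+) G q'.
Proof.
move=> e0; have [e' e'0 [d1 d10 fp]] := far_planefar e0.
have /andP [e'p e'1] := e'0.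
have k0 : 0 < e' ^+ 2 / 8 by rewrite divr_gt0 ?exprn_gt0.
have [m m0 hm] := height2_small g k0.
(* The bound [e' / 7] makes [2 * (3 * d) ^+ 2] at most the [3 / 8 * e' ^+ 2] of the radial
   estimates; the bounds 1 and [m] give [pz p ^+ 2 < d ^+ 2 <= d <= m]. *)
exists (Num.min (Num.min d1 (e' / 7)) (Num.min 1 m)).
  by rewrite !lt_min d10 m0 ltr01 divr_gt0.
move=> d /andP [d0]; rewrite !le_min => /andP [/andP [dd1 de]] /andP [d_1 dm].
rewrite ler_pdivlMr // in de.
have de2 : 2 * (3 * d) ^+ 2 <= 3 / 8 * e' ^+ 2 by nra.
move=> p Sp zp; have [po ph] := surface_region Sp.
have [|lo|[i /andP [i0 ig] hi]] := hm (px p) (py p).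
- rewrite -(surfaceE g p).1 //; apply: lt_le_trans dm.
  by move: zp; rewrite ltr_norml => /andP [? ?]; nra.
(* Doubling [p] leaves the square of half-side [r]: otherwise [px p ^+ 2 + py p ^+ 2 <= r ^+ 2 / 2],
   too small near the outer circle. *)
- pose v : pt := (2 * px p, 2 * py p, 2 * pz p).
  have [G HG] := downcross_homotopy p v d0.
  pose r : R := (3 * g + 2)%:R.
  have r1 : 2%:R <= r by rewrite /r ler_nat leq_addl.
  have rv : r < `|px v| \/ r < `|py v|.
    have [|h1] := ltP r `|px v|; [by left|right].
    rewrite ltNge; apply/negP => h2; move: h1 h2 lo; rewrite !ler_norml /outer_factor -/r.
    rewrite /px /py /= -/(px p) -/(py p) => /andP [? ?] /andP [? ?] lo.
    by nra.
  have [G' HG'] := downcross_outside rv.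
  exists None, (fun q => G q (+) G' q) => q q' Sq Sq' qq pq; rewrite addbF.
  have [[? ?] [? ?]] := (surface_box Sq, surface_box Sq').
  have := HG q q' qq; rewrite HG' // => HG''.
  have /HG'' : forall t : R, 0 <= t <= 1 -> planefar (3 * d) (seg p v t) q.
    move=> t /andP [t0 t1]; apply: planefar_sqr; first by lra.
    apply: le_trans de2 _.
    have -> : px (seg p v t) = (1 + t) * px p by rewrite /v /seg /px /py /=; ring.
    have -> : py (seg p v t) = (1 + t) * py p by rewrite /v /seg /px /py /=; ring.
    apply: (@radial_outward r); first by apply/andP; split; lra.
    + by apply: sqr_planefar; [apply: ltW|apply: fp => //; apply: lt_le_trans zp dd1].
    + by have [] := surface_region Sq; rewrite /outer_factor -/r => ? _; lra.
    + by move: lo; rewrite /outer_factor -/r; lra.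
  by move: (downcross q q' p) (G q) (G q') (G' q) (G' q') => [] [] [] [] [].
- pose o := hole_center i.
  have [G HG] := downcross_homotopy p o d0.
  case: i i0 ig hi @o HG => // i _ ig hi o HG; exists (Some (Ordinal ig)), G.
  move=> q q' Sq Sq' qq pq; apply: HG => // t /andP [t0 t1].
  apply: planefar_sqr; first by lra.
  apply: le_trans de2 _.
  pose c : R := (3 * i.+1)%:R.
  have -> : px (seg p o t) - px q = (1 - t) * (px p - c) - (px q - c).
    by rewrite /o /seg /px /py /= -/c; ring.
  have -> : py (seg p o t) = (1 - t) * py p by rewrite /o /seg /px /py /=; ring.
  apply: radial_inward => //; first by apply/andP; split; lra.
  + have -> : px p - c - (px q - c) = px p - px q by ring.
    by apply: sqr_planefar; [apply: ltW|apply: fp => //; apply: lt_le_trans zp dd1].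
  + by have [_ /(_ i.+1)] := surface_region Sq; rewrite ig /hole_factor -/c => /(_ isT); lra.
  + by move: hi; rewrite /hole_factor -/c; lra.
Qed.

End Fold.

(** * Non-embeddability of K_{3,n} *)

(* [btauto] knows [xorb] but not [addb]. *)
Lemma xorbE a b : a (+) b = xorb a b. Proof. by case: a b => [] []. Qed.

(** Elimination over the field with two elements: what follows from an equation by addition becomes
    a tautology for [btauto]. *)
Lemma xorbI a b c d : a = b -> xorb (xorb a b) (xorb c d) = false -> c = d.
Proof. by case: a b c d => [] [] [] []. Qed.

(** * Crossings of two separated chains on the surface *)

Section ChainPair.
Variables (R : realType) (g : nat) (e d : R).
Local Notation pt := (R * R * R)%type.
Local Notation S := (@surface R g).
Variables (k : pt -> option 'I_g) (G : pt -> pt -> bool).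
Implicit Types (p q : pt) (E F : pt -> Prop).

Definition step E p p' := [/\ E p, E p', S p, S p' & nearby d p p'].

Definition hole_parity (y : pt) m (i : 'I_g) :=
  xsum (fun q q' => downcross q q' (hole_center R i.+1)) y m.

(** A change of sheet happens at a fold; [k p'] names its hole, and [None], the outer circle,
    contributes nothing. *)
Definition fold_pairing (x : pt) l (h : 'I_g -> bool) :=
  xsum (fun p p' => (top p (+) top p') && oapp h false (k p')) x l.

(** These are the boundary terms that depend on one chain and one end [q] of the other: the first
    comes from [xsum_rect], the other three from [top_weighted]. *)
Definition potential (x : pt) l q :=
  xsum (fun p p' => upcross p p' q) x l
  (+) xsum (fun p p' => top p && upcross p p' q) x l
  (+) xsum (fun p p' => (top p (+) top p') && G p' q) x l
  (+) (top q && xsum (fun p p' => downcross p p' q) x l).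

Hypothesis cross_top_jump : forall p p' q q', S p -> S q ->
  nearby d p p' -> nearby d q q' -> far e p q -> cross p p' q q' -> top p (+) top q.

Hypothesis fold_jump : forall p, S p -> `|pz p| < d -> forall q q',
  S q -> S q' -> nearby d q q' -> far e p q ->
  downcross q q' p (+) oapp (fun i : 'I_g => downcross q q' (hole_center R i.+1)) false (k p)
  = G p q (+) G p q'.

Lemma far_sym p q : far e p q = far e q p.
Proof. by rewrite /far (distrC (px p)) (distrC (py p)) (distrC (pz p)). Qed.

Lemma far_neq p q : 0 < e -> far e p q -> p != q.
Proof.
move=> e0; apply: contraTneq => ->.
by rewrite /far !subrr normr0 leNgt e0.
Qed.

Lemma xsum_downcross (y : pt) m p :
  xsum (fun q q' => downcross q q' p) y m =
  xsum (fun q q' => upcross q q' p) y m (+) lexlt p y (+) lexlt p (last y m).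
Proof.
rewrite -addbA -(xsum_tele (lexlt p)) -xsumD.
apply: (@eq_xsum _ (fun _ _ => True)) => [|a b _]; first by elim: m y => /=.
by rewrite /downcross addbA.
Qed.

Section Pair.
Variables (E F : pt -> Prop).
Hypothesis e0 : 0 < e.
Hypothesis EF : forall p q, E p -> F q -> far e p q.

Lemma fold_sum p p' y m : step E p p' -> chain (step F) y m -> top p (+) top p' ->
  xsum (fun q q' => downcross q q' p') y m =
  oapp (hole_parity y m) false (k p') (+) G p' y (+) G p' (last y m).
Proof.
move=> [Ep Ep' Sp Sp' [_ _ pp']] Fm jump.
(* A change of [top] over a height difference below [d] puts [p'] near a fold, where [fold_jump]
   applies. *)
have zp' : `|pz p'| < d.
  move: jump pp'; rewrite /top !ltr_norml.
  by case: (ltrP 0 (pz p)) => ?; case: (ltrP 0 (pz p')) => ? //= _ /andP [? ?]; lra.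
rewrite -addbA -(xsum_tele (G p')).
have -> : oapp (hole_parity y m) false (k p') = xsum (fun q q' =>
    oapp (fun i : 'I_g => downcross q q' (hole_center R i.+1)) false (k p')) y m.
  case: (k p') => //=.
  by elim: (m) (y) => //= ? ? IHm ?; rewrite -IHm.
rewrite -xsumD; apply: (eq_xsum Fm) => q q' [Fq Fq' Sq Sq' qq'].
rewrite -(fold_jump Sp' zp' Sq Sq' qq'); last exact: EF.
by rewrite [RHS]addbC addbK.
Qed.

(** Summation by parts with weight [top], which changes only at folds; there [fold_sum] replaces the
    ray from [p'] by one from the centre of a hole. *)
Lemma top_weighted x l y m : chain (step E) x l -> chain (step F) y m ->
  xsum (fun p p' => top p && xsum (cross p p') y m) x l =
    xsum (fun p p' => top p && upcross p p' y) x l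
    (+) xsum (fun p p' => top p && upcross p p' (last y m)) x l
    (+) xsum (fun p p' => (top p (+) top p') && G p' y) x l
    (+) xsum (fun p p' => (top p (+) top p') && G p' (last y m)) x l
    (+) (top x && xsum (fun q q' => downcross q q' x) y m)
    (+) (top (last x l) && xsum (fun q q' => downcross q q' (last x l)) y m)
    (+) fold_pairing x l (hole_parity y m).
Proof.
move=> El Fm; rewrite xsum_rect_weighted /=.
rewrite (eq_xsum (c := fun p p' => (top p (+) top p') && _) El
  (d := fun p p' => ((top p (+) top p') && oapp (hole_parity y m) false (k p'))
    (+) ((top p (+) top p') && G p' y) (+) ((top p (+) top p') && G p' (last y m)))).
  rewrite 2!xsumD -/(fold_pairing x l (hole_parity y m)).
  move: (_ && _) (_ && _) (fold_pairing _ _ _).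
  move: (xsum _ _ _) (xsum _ _ _) (xsum _ _ _) (xsum _ _ _).
  by do 7 case.
move=> p p' pp'; case: (boolP (top p (+) top p')) => //= jump.
exact: (fold_sum pp').
Qed.

(** When two steps cross, exactly one of [top p] and [top q] holds, so that the right-hand side
    counts the crossing once. *)
Lemma cross_split x l y m : chain (step E) x l -> chain (step F) y m ->
  xsum (fun p p' => xsum (cross p p') y m) x l =
  xsum (fun p p' => top p && xsum (cross p p') y m) x l (+)
  xsum (fun q q' => top q && xsum (cross q q') x l) y m.
Proof.
move=> El Fm.
have -> : xsum (fun q q' => top q && xsum (cross q q') x l) y m =
          xsum (fun p p' => xsum (fun q q' => top q && cross p p' q q') y m) x l.
  rewrite xsum_exchange; apply: (eq_xsum Fm) => q q' [Fq Fq' _ _ _].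
  rewrite -xsum_andl; apply: (eq_xsum El) => p p' [Ep Ep' _ _ _].
  congr (_ && _); apply/esym/cross_sym; apply: far_neq => //; exact: EF.
rewrite -xsumD; apply: (eq_xsum El) => p p' [Ep _ Sp _ pp'].
rewrite -xsum_andl -xsumD; apply: (eq_xsum Fm) => q q' [Fq _ Sq _ qq'].
have := @cross_top_jump p p' q q' Sp Sq pp' qq' (EF Ep Fq).
by case: cross (top p) (top q) => [] [] [] // /(_ isT).
Qed.

End Pair.

(** The crossings are counted twice, by [xsum_rect] and by [cross_split] with [top_weighted], and
    the results are compared. The terms in [lexlt] come from turning downward rays into upward
    ones. *)
Lemma potential_pairing E F x l y m : 0 < e ->
  (forall p q, E p -> F q -> far e p q) ->
  chain (step E) x l -> chain (step F) y m ->
  potential x l y (+) potential x l (last y m)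
  (+) potential y m x (+) potential y m (last x l)
  (+) lexlt x y (+) lexlt x (last y m)
  (+) lexlt (last x l) y (+) lexlt (last x l) (last y m)
  = fold_pairing x l (hole_parity y m) (+) fold_pairing y m (hole_parity x l).
Proof.
move=> e0 EF El Fm.
have FE p q : F p -> E q -> far e p q by rewrite far_sym => Fp Eq; apply: EF.
have := cross_split e0 EF El Fm.
rewrite (top_weighted EF El Fm) (top_weighted FE Fm El).
have -> := xsum_rect (@upcross R) (@downcross R) x l y m.
rewrite /potential !(xsum_downcross y m) !xorbE => H.
apply: (@xorbI _ _ _ _ H).
by btauto.
Qed.

End ChainPair.

(* [P] and [Q] stand for the potential of the path from the [x]-th vertex to
   [J i] at the two kinds of vertices.  For fixed [x] and [y], adding the
   equations for [i, j] and [j, i] removes [B], and [s4] contributes 1; the sum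
   over the three pairs [{i, j}] then says that [x] and [y] have different total
   [Q], which is impossible for three letters and two values. *)
Lemma K33_parity (I : Type) (P : 'I_3 -> I -> 'I_3 -> bool)
    (Q : 'I_3 -> I -> I -> bool) (s1 : 'I_3 -> 'I_3 -> bool) (s2 : 'I_3 -> I -> bool)
    (s3 : I -> 'I_3 -> bool) (s4 : I -> I -> bool) (B : 'I_3 -> 'I_3 -> bool)
    (J : 'I_3 -> I) :
  (forall i j, i != j -> s4 (J j) (J i) = ~~ s4 (J i) (J j)) ->
  (forall x y i j, x != y -> i != j ->
    P x (J i) y (+) Q x (J i) (J j) (+) P y (J j) x (+) Q y (J j) (J i)
    (+) s1 x y (+) s2 x (J j) (+) s3 (J i) y (+) s4 (J i) (J j) = B x y) -> False.
Proof.
move=> anti H.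
have pairs x y : x != y -> forall i j, i != j ->
    P x (J i) y (+) P x (J j) y (+) Q x (J i) (J j) (+) Q x (J j) (J i)
    (+) P y (J i) x (+) P y (J j) x (+) Q y (J i) (J j) (+) Q y (J j) (J i)
    (+) s2 x (J i) (+) s2 x (J j) (+) s3 (J i) y (+) s3 (J j) y = true.
  move=> xy i j ij; have := H x y i j xy ij; rewrite -(H x y j i xy) 1?eq_sym //.
  rewrite (anti i j) // !xorbE => E; apply: (xorbI E).
  by btauto.
have [n01 n02 n12] : [/\ (0 : 'I_3) != 1, (0 : 'I_3) != 2%:R & (1 : 'I_3) != 2%:R] by [].
pose q x := Q x (J 0) (J 1) (+) Q x (J 1) (J 0) (+) Q x (J 0) (J 2%:R)
  (+) Q x (J 2%:R) (J 0) (+) Q x (J 1) (J 2%:R) (+) Q x (J 2%:R) (J 1).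
have qq x y : x != y -> q x (+) q y = true.
  move=> xy; have := congr2 xorb (congr2 xorb (pairs x y xy _ _ n01)
    (pairs x y xy _ _ n02)) (pairs x y xy _ _ n12).
  by rewrite /q !xorbE => E; apply: (xorbI E); btauto.
move: (qq _ _ n01) (qq _ _ n02) (qq _ _ n12).
by move: (q 0) (q 1) (q 2%:R) => [] [] [].
Qed.

Lemma pigeonhole3 (I C : finType) (f : I -> C) : (2 * #|C| < #|I|)%N ->
  exists2 J : 'I_3 -> I, injective J & forall i j, f (J i) = f (J j).
Proof.
move=> CI; have [c c2] : exists c, (2 < #|[pred i | f i == c]|)%N.
  apply/existsP; apply: contraLR CI => /existsPn h; rewrite -leqNgt.
  rewrite -sum1_card (partition_big f predT) //= mulnC -sum_nat_const.
  by apply: leq_sum => c _; rewrite sum1_card leqNgt h.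
have c2' : (3 <= #|[pred i | f i == c]|)%N by [].
exists (fun i => enum_val (widen_ord c2' i)).
  by move=> i j /enum_val_inj /(congr1 val) /= /val_inj.
by move=> i j; have := (enum_valP (widen_ord c2' i), enum_valP (widen_ord c2' j));
  rewrite !inE => -[/eqP -> /eqP ->].
Qed.

Section Classes.
Variables (R : realType) (g : nat) (k : R * R * R -> option 'I_g).
Local Notation pt := (R * R * R)%type.

(** Two bits for each hole. The three paths to a vertex have [64 ^ g] possible triples of classes,
    so among more than [2 * 64 ^ g] vertices three share the same triple. *)
Definition fold_class (x : pt) l : {ffun 'I_g -> bool * bool} :=
  [ffun i => (xsum (fun p p' => (top p (+) top p') && (k p' == Some i)) x l,
              hole_parity x l i)].

Lemma fold_pairingE x l h : fold_pairing k x l h =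
  \big[addb/false]_(i < g) ((fold_class x l i).1 && h i).
Proof.
under eq_bigr do rewrite ffunE /=.
elim: l x => [|y l IHl] x /=; first by rewrite big1.
rewrite /fold_pairing /= -/(fold_pairing k y l h) IHl.
under [RHS]eq_bigr do rewrite andb_addl.
rewrite big_split /=; congr (_ (+) _).
case: (_ (+) _) => /=; last by rewrite big1.
case: (k y) => [i|] /=; last by rewrite big1.
rewrite (bigD1 i) //= eqxx big1 ?addbF // => j ji.
by rewrite (_ : _ == _ = false) //; apply/eqP => -[/eqP]; rewrite eq_sym (negbTE ji).
Qed.

Lemma eq_fold_class x l x' l' y m y' m' :
  fold_class x l = fold_class x' l' -> fold_class y m = fold_class y' m' ->
  fold_pairing k x l (hole_parity y m) = fold_pairing k x' l' (hole_parity y' m').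
Proof.
move=> xx yy; rewrite !fold_pairingE xx; apply: eq_bigr => i _.
by congr (_ && _); move/ffunP: yy => /(_ i); rewrite !ffunE => -[].
Qed.

End Classes.

Lemma K3n_chains (R : realType) (g : nat) (e : R) (I : finType) : 0 < e ->
  (2 * 64 ^ g < #|I|)%N -> exists2 d, 0 < d &
  forall (r : 'I_3 -> R * R * R) (m : I -> R * R * R)
    (l : 'I_3 -> I -> seq (R * R * R)) (E : 'I_3 -> I -> R * R * R -> Prop),
  injective m ->
  (forall x i, chain (step g d (E x i)) (r x) (l x i)) ->
  (forall x i, last (r x) (l x i) = m i) ->
  (forall x y i j p q, x != y -> i != j -> E x i p -> E y j q -> far e p q) ->
  False.
Proof.
move=> e0 cardI; have [d1 d10 H1] := cross_top g e0.
have [d2 d20 H2] := fold_downcross g e0.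
have d0 : 0 < Num.min d1 d2 by rewrite lt_min d10.
exists (Num.min d1 d2) => // r m l E m_inj El lm sep.
have {}H1 := H1 (Num.min d1 d2); rewrite d0 ge_min lexx /= in H1.
have {}H2 := H2 (Num.min d1 d2); rewrite d0 ge_min lexx orbT /= in H2.
have {}H1 := H1 isT; have {}H2 := H2 isT.
have /choice [kG HkG] p : exists kG : option 'I_g * (R * R * R -> bool),
    @surface R g p -> `|pz p| < Num.min d1 d2 -> forall q q',
    @surface R g q -> @surface R g q' -> nearby (Num.min d1 d2) q q' -> far e p q ->
    downcross q q' p (+)
      oapp (fun i : 'I_g => downcross q q' (hole_center R i.+1)) false kG.1
    = kG.2 q (+) kG.2 q'.
  have [[Sp zp]|n] := pselect (@surface R g p /\ `|pz p| < Num.min d1 d2).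
    have [k [G kG]] := H2 p Sp zp; exists (k, G) => _ _ q q' ? ? ? ?.
    by rewrite -kG //; case: (k).
  (* Off the surface or away from the folds, the condition is vacuous. *)
  by exists (None, xpred0) => Sp zp; case: n.
pose k p := (kG p).1; pose G p := (kG p).2.
pose cl i : {ffun 'I_3 -> {ffun 'I_g -> bool * bool}} :=
  [ffun x => fold_class k (r x) (l x i)].
have card_cl : (2 * #|{: {ffun 'I_3 -> {ffun 'I_g -> bool * bool}}}| < #|I|)%N.
  by rewrite !card_ffun card_prod card_bool !card_ord -expnM (mulnC g) expnM.
have [J J_inj Jcl] := pigeonhole3 cl card_cl.
have clE x i j : fold_class k (r x) (l x (J i)) = fold_class k (r x) (l x (J j)).
  by have := congr1 (fun h : {ffun 'I_3 -> _} => h x) (Jcl i j); rewrite !ffunE.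
apply: (@K33_parity I (fun x i y => potential G (r x) (l x i) (r y))
  (fun x i j => potential G (r x) (l x i) (m j)) (fun x y => lexlt (r x) (r y))
  (fun x j => lexlt (r x) (m j)) (fun i y => lexlt (m i) (r y))
  (fun i j => lexlt (m i) (m j))
  (* Equal classes make the pairings independent of [i] and [j]; [J 0] serves as reference. *)
  (fun x y => fold_pairing k (r x) (l x (J 0)) (hole_parity (r y) (l y (J 0)))
    (+) fold_pairing k (r y) (l y (J 0)) (hole_parity (r x) (l x (J 0)))) J).
  move=> i j ij; apply: lexlt_total; rewrite (inj_eq m_inj) (inj_eq J_inj) //.
move=> x y i j xy ij.
have EF p q : E x (J i) p -> E y (J j) q -> far e p q.
  by apply: sep; rewrite ?(inj_eq J_inj).
have := potential_pairing H1 (fun p Sp zp => HkG p Sp zp) e0 EF (El x (J i)) (El y (J j)).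
rewrite !lm (eq_fold_class (clE x i 0) (clE y j 0)).
rewrite (eq_fold_class (clE y j 0) (clE x i 0)) => <-.
by rewrite !xorbE; btauto.
Qed.

(** * Compactness of arcs and sampling of drawings *)

Section Arcs.
Local Open Scope classical_set_scope.
Variable R : realType.
Local Notation pt := (R * R * R)%type.

Lemma segment_uniform_continuous (f : R -> pt) (e : R) :
  {within `[0, 1], continuous f} -> 0 < e -> exists2 d, 0 < d &
  forall s t, 0 <= s <= 1 -> 0 <= t <= 1 -> `|s - t| < d -> `|f s - f t| < e.
Proof.
move=> /subspace_continuousP cf e0.
have /compact_near_coveringP cov := @segment_compact R 0 1.
pose P (d s : R) := forall t, 0 <= t <= 1 -> 0 <= s <= 1 -> `|s - t| < d -> `|f s - f t| < e.
have : \forall d \near 0^'+, `[0, 1] `<=` P d.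
  apply: cov => s s01.
  have /cvgrPdist_lt /(_ (e / 2)) := cf s s01; rewrite divr_gt0 // => /(_ isT).
  rewrite near_withinE => /nbhs_ballP [r /= r0 rP].
  have fr t : 0 <= t <= 1 -> `|s - t| < r -> `|f s - f t| < e / 2.
    by move=> t01 st; apply: rP => //=; rewrite in_itv.
  exists (ball s (r / 2), [set d | d < r / 2]) => [|[s' d] /= [ss dr] t t01 s01' st].
    split; first by apply: nbhsx_ballx; rewrite divr_gt0.
    by apply: nbhs_right_lt; rewrite divr_gt0.
  have ss2 : `|s - s'| < r / 2 by [].
  have h1 : `|s - s'| < r by lra.
  have h2 : `|s - t| < r by have := ler_distD s' s t; lra.
  have := ler_distD (f s) (f s') (f t); rewrite (distrC (f s') (f s)).
  by have := (fr s' s01' h1, fr t t01 h2) => -[]; lra.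
move=> near_d; have [d [d0 dP]] := filter_ex (filterI (nbhs_right_gt 0) near_d).
by exists d => // s t s01 t01; apply: dP.
Qed.

Lemma nearby_norm (d : R) (p q : pt) : `|p - q| < d -> nearby d p q.
Proof. by rewrite !prod_normE !gt_max => /andP [/andP [? ?] ?]. Qed.

Lemma far_norm (e : R) (p q : pt) : e <= `|p - q| -> far e p q.
Proof. by rewrite !prod_normE !le_max -orbA. Qed.

(** The distance attains a minimum on the product of the two compact images, and it is positive by
    disjointness. *)
Lemma disjoint_arcs_far (f h : R -> pt) :
  {within `[0, 1], continuous f} -> {within `[0, 1], continuous h} ->
  (forall s t, 0 <= s <= 1 -> 0 <= t <= 1 -> f s <> h t) ->
  exists2 e, 0 < e & forall s t, 0 <= s <= 1 -> 0 <= t <= 1 -> far e (f s) (h t).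
Proof.
move=> cf ch fh; have I01 (a : R) : `[0, 1] a = (0 <= a <= 1) :> Prop.
  by rewrite /= in_itv.
have z01 : `[(0 : R), 1] 0 by rewrite I01 lexx ler01.
have [|||pq pqin pqmin] := @compact_EVT_min _ R (fun pq : pt * pt => `|pq.1 - pq.2|)
  ((f @` `[0, 1]) `*` (h @` `[0, 1])).
- by exists (f 0, h 0); split; exists 0.
- by apply: compact_setX; apply: continuous_compact => //; exact: segment_compact.
- apply: continuous_subspaceT => pq; apply: cvg_norm.
  by apply: cvgB; [exact: cvg_fst|exact: cvg_snd].
move: pqin; rewrite inE => -[[s s01 fs] [t t01 ht]].
exists `|pq.1 - pq.2|.
  by rewrite normr_gt0 subr_eq0 -fs -ht; apply/eqP; apply: fh; rewrite -I01.
move=> s' t'; rewrite -!I01 => s01' t01'; apply: far_norm.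
by apply: (pqmin (f s', h t')); rewrite inE; split; [exists s'|exists t'].
Qed.

Lemma uniform_threshold (T : finType) (P : T -> R -> Prop) :
  (forall x a b, a <= b -> P x b -> P x a) ->
  (forall x, exists2 e, 0 < e & P x e) -> exists2 e, 0 < e & forall x, P x e.
Proof.
move=> Pmono /(_ _)/cid2 h; pose e x := s2val (h x).
exists (\big[Num.min/1]_x e x).
  by elim/big_ind: _ => // [a b a0 b0|x _]; [rewrite lt_min a0|exact: (s2valP (h x))].
move=> x; apply: Pmono (s2valP' (h x)).
by apply: bigmin_le_cond.
Qed.

End Arcs.

Section Embedded.
Variables (R : realType) (g : nat) (Gamma : sgraph).
Local Notation pt3 := (R * R * R)%type.
Variables (pt : Gamma -> pt3) (arc : Gamma -> Gamma -> R -> pt3).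
Hypothesis drawn : drawing (@surface R g) pt arc.

Lemma drawing_arc_disjoint u v x y s t : adj u v -> adj x y ->
  u != x -> u != y -> v != x -> v != y -> 0 <= s <= 1 -> 0 <= t <= 1 ->
  arc u v s <> arc x y t.
Proof.
move=> uv xy ux uy vx vy s01 t01.
have ends a b r : adj a b -> 0 <= r <= 1 ->
    [\/ arc a b r = pt a, arc a b r = pt b | 0 < r < 1].
  move=> ab; rewrite !le_eqVlt => /andP [/predU1P [<- _|r0 /predU1P [->|r1]]].
  - by constructor 1; apply: (drawing_arc0 drawn).
  - by constructor 2; apply: (drawing_arc1 drawn).
  - by constructor 3; rewrite r0.
have noneq a b : a != b -> pt a <> pt b.
  by move=> /eqP ab /(drawing_pt_inj drawn).
case: (ends _ _ _ uv s01) => [->|->|s0]; case: (ends _ _ _ xy t01) => [->|->|t0];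
  try exact: noneq; try by move=> /esym; apply: (drawing_arc_pt drawn).
- exact: (drawing_arc_pt drawn).
- exact: (drawing_arc_pt drawn).
move=> /(drawing_arc_arc drawn uv xy s0 t0) [[xu _]|[xv _]].
  by rewrite xu eqxx in ux.
by rewrite xv eqxx in vx.
Qed.

Lemma drawing_separation : exists2 e : R, 0 < e & forall u v x y s t,
  adj u v -> adj x y -> u != x -> u != y -> v != x -> v != y ->
  0 <= s <= 1 -> 0 <= t <= 1 -> far e (arc u v s) (arc x y t).
Proof.
pose P (q : Gamma * Gamma * Gamma * Gamma) (e : R) :=
  let: (u, v, x, y) := q in forall s t,
  adj u v -> adj x y -> u != x -> u != y -> v != x -> v != y ->
  0 <= s <= 1 -> 0 <= t <= 1 -> far e (arc u v s) (arc x y t).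
have [||e e0 eP] := @uniform_threshold R _ P.
- move=> [[[u v] x] y] a b ab Pb s t uv xy ux uy vx vy s01 t01.
  move: (Pb s t uv xy ux uy vx vy s01 t01); rewrite /far.
  by case/or3P => /(le_trans ab) ->; rewrite ?orbT.
- move=> [[[u v] x] y].
  have [[uv xy ux [uy vx vy]]|n] :=
    pselect [/\ adj u v, adj x y, u != x & [/\ u != y, v != x & v != y]].
    have [|||e e0 h] := @disjoint_arcs_far R (arc u v) (arc x y).
    + exact: (drawing_arc_cont drawn).
    + exact: (drawing_arc_cont drawn).
    + by move=> s t s01 t01; apply: drawing_arc_disjoint.
    by exists e => // s t _ _ _ _ _ _; apply: h.
  by exists 1 => // s t uv xy ux uy vx vy; case: n.
by exists e => // u v x y; apply: (eP (u, v, x, y)).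
Qed.

(** The samples of an arc omit its starting point, which already ends the preceding part of the
    chain. *)
Fixpoint sample_walk n u w : seq pt3 :=
  if w is v :: w' then
    [seq arc u v (j%:R / n.+1%:R) | j <- iota 1 n.+1] ++ sample_walk n v w'
  else [::].

(** The ends of the arc need not be consecutive in [w]. Disjoint vertex sets still separate the
    arcs, and the predicate is monotone in [w], as the induction in [drawing_sampling] requires. *)
Definition on_walk (w : seq Gamma) p := exists u v t,
  [/\ adj u v, u \in w, v \in w, 0 <= t <= 1 & p = arc u v t].

Lemma drawing_sampling d : 0 < d -> exists n, forall u w, path (@adj Gamma) u w ->
  chain (step g d (on_walk (u :: w))) (pt u) (sample_walk n u w) /\
  last (pt u) (sample_walk n u w) = pt (last u w).
Proof.
move=> d0; pose P (q : Gamma * Gamma) (a : R) := adj q.1 q.2 -> forall s t,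
  0 <= s <= 1 -> 0 <= t <= 1 -> `|s - t| < a -> nearby d (arc q.1 q.2 s) (arc q.1 q.2 t).
have [||a a0 aP] := @uniform_threshold R _ P.
- by move=> q a b ab Pb uv s t s01 t01 st; apply: Pb => //; apply: lt_le_trans st ab.
- move=> [u v]; have [uv|n] := boolP (adj u v); last first.
    by exists 1 => // uv; rewrite /= uv in n.
  have [a a0 h] := segment_uniform_continuous (drawing_arc_cont drawn uv) d0.
  by exists a => // _ s t s01 t01 st; apply: nearby_norm; apply: h.
have [n na] : exists n : nat, a^-1 < n.+1%:R.
  exists (Num.bound a^-1); apply: lt_trans (archi_boundP _) _.
    by rewrite invr_ge0 ltW.
  by rewrite ltr_nat.
exists n => u w; elim: w u => [//|v w IHw] u; rewrite [path _ _ _]/= => /andP [uv vw].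
have [cw lw] := IHw v vw.
pose f j := arc u v (j%:R / n.+1%:R).
have f0 : f 0%N = pt u by rewrite /f mul0r (drawing_arc0 drawn).
have fn : f (0 + n.+1)%N = pt v by rewrite /f add0n divff ?pnatr_eq0 // (drawing_arc1 drawn).
have [|fc fl] := @chain_subdivision _ (step g d (on_walk [:: u, v & w])) f n.+1 0.
  move=> j /andP [_ jn].
  have j01 i : (i <= n.+1)%N -> 0 <= (i%:R / n.+1%:R : R) <= 1.
    by move=> iN; rewrite divr_ge0 //= ler_pdivrMr ?ltr0n // mul1r ler_nat.
  have on i : (i <= n.+1)%N -> on_walk [:: u, v & w] (f i).
    by move=> iN; exists u, v, (i%:R / n.+1%:R); rewrite !inE !eqxx orbT j01.
  split; [exact/on/ltnW|exact: on|..].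
  + by apply: (drawing_arc_in drawn) => //; exact/j01/ltnW.
  + by apply: (drawing_arc_in drawn) => //; exact/j01.
  apply: (aP (u, v)) => //; [exact/j01/ltnW|exact: j01|].
  rewrite -mulrBl -natr1 opprD addNKr normrM normrN1 mul1r normfV ger0_norm //.
  by rewrite -[a]invrK ltf_pV2 // posrE ?invr_gt0.
have -> : sample_walk n u (v :: w) = [seq f j | j <- iota 1 n.+1] ++ sample_walk n v w by [].
rewrite last_cat -f0 fl fn lw; split=> //; apply: chain_cat => //.
rewrite fl fn; apply: chain_sub cw => p q [[x [y [t [xy xw yw t01 ->]]]]].
move=> [x' [y' [t' [xy' xw' yw' t01' ->]]]] Sp Sq pq; split=> //.
  by exists x, y, t; rewrite !(in_cons u) xw yw !orbT.
by exists x', y', t'; rewrite !(in_cons u) xw' yw' !orbT.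
Qed.

End Embedded.

(* The walks form a minor model of K_{3,#|I|}. *)
Lemma embeds_K3n (R : realType) (g : nat) (Gamma : sgraph) (I : finType)
    (r : 'I_3 -> Gamma) (m : I -> Gamma) (w : 'I_3 -> I -> seq Gamma) :
  injective m ->
  (forall x i, path (@adj Gamma) (r x) (w x i)) ->
  (forall x i, last (r x) (w x i) = m i) ->
  (forall x y i j v, x != y -> i != j -> v \in r x :: w x i -> v \notin r y :: w y j) ->
  embeds R (@surface R g) Gamma -> (#|I| <= 2 * 64 ^ g)%N.
Proof.
move=> m_inj rw wm disj [pt [arc drawn]]; rewrite leqNgt; apply/negP => cardI.
have [e e0 sep] := drawing_separation drawn.
have [d d0 noK] := K3n_chains e0 cardI.
have [n samp] := drawing_sampling drawn d0.
apply: (noK (fun x => pt (r x)) (fun i => pt (m i))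
  (fun x i => sample_walk arc n (r x) (w x i)) (fun x i => on_walk arc (r x :: w x i))).
- by move=> i j /(drawing_pt_inj drawn) /m_inj.
- by move=> x i; have [] := samp _ _ (rw x i).
- by move=> x i; have [_ ->] := samp _ _ (rw x i); rewrite wm.
- move=> x y i j p q xy ij [u [v [s [uv uw vw s01 ->]]]] [u' [v' [t [uv' uw' vw' t01 ->]]]].
  have neq a b : a \in r x :: w x i -> b \in r y :: w y j -> a != b.
    by move=> aw; apply: contraTneq => <-; apply: disj aw.
  by apply: sep => //; apply: neq.
Qed.

(** * Subgroup graphs *)

Section SubgroupWalks.
Local Open Scope nat_scope.
Local Open Scope group_scope.
Variables (gT : finGroupType) (G : {group gT}).
Local Notation L := (subgroup_graph G).
Implicit Types u v : subgroup_of G.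

Lemma maximal_covered u v : maximal (val u) (val v) -> covered u v.
Proof.
move=> /maxgroupP [uv umax]; rewrite /covered uv /=; apply/forallP => K.
apply/negP => /andP [uK Kv].
have := umax _ Kv (proper_sub uK).
by move: uK; rewrite properE => /andP [_ +] E; rewrite E subxx.
Qed.

(** Induction on the order of [val v], through a maximal subgroup containing [val u]. *)
Lemma subgroup_walk_up u v : val u \subset val v -> exists w : seq L,
  [/\ path (@adj L) u w, last (u : L) w = v &
      forall x, x \in (u : L) :: w -> (val u \subset val x) && (val x \subset val v)].
Proof.
have [n] := ubnP #|val v|; elim: n v => // n IHn v vn uv.
have [uv_eq|[M maxM uM]] := maximal_exists uv.
  have -> : v = u by apply/val_inj/group_inj.
  by exists [::]; split=> // x; rewrite inE => /eqP ->; rewrite subxx.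
have Mv := maxgroupp maxM.
pose m : subgroup_of G := exist _ M (fintype.subset_trans (proper_sub Mv) (valP v)).
have [|w [pw lw inw]] := IHn m _ uM.
  by rewrite (leq_trans (proper_card Mv)).
exists (rcons w v); split; rewrite ?last_rcons //.
  by rewrite rcons_path pw lw /= /subgroup_adj (@maximal_covered m v).
move=> x; rewrite -rcons_cons mem_rcons in_cons => /predU1P [->|/inw /andP [-> xM]].
  by rewrite uv subxx.
exact: fintype.subset_trans xM (proper_sub Mv).
Qed.

Lemma subgroup_walk_down u v : val u \subset val v -> exists w : seq L,
  [/\ path (@adj L) v w, last (v : L) w = u &
      forall x, x \in (v : L) :: w -> (val u \subset val x) && (val x \subset val v)].
Proof.
move=> /subgroup_walk_up [w [pw lw inw]]; exists (rev (belast (u : L) w)).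
have E : v :: rev (belast (u : L) w) = rev ((u : L) :: w).
  by rewrite [in RHS]lastI rev_rcons lw.
split.
- rewrite -lw rev_path (@eq_path _ _ (@adj L)) // => x y; exact: adj_sym.
- by rewrite -[LHS]/(last v (v :: _)) E rev_cons last_rcons.
- by move=> x; rewrite E mem_rev; apply: inw.
Qed.

(* The three roots of the minor are [G], [C] and the trivial group. *)
Lemma embeds_antichain (R : realType) (g : nat) (C : {group gT})
    (AA : {set {group gT}}) (M : {group gT} -> {group gT}) :
  (forall A B, A \in AA -> B \in AA -> A \subset B -> A = B) ->
  (forall A, A \in AA -> A \subset G) ->
  (forall A, A \in AA -> C \subset A) ->
  (forall A, A \in AA -> maximal (M A) A) ->
  (forall A, A \in AA -> ~~ (C \subset M A)) ->
  embeds R (@surface R g) L -> #|AA| <= (2 * 64 ^ g)%N.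
Proof.
move=> anti AG CA maxM CM emb.
have [->|[A0 A0A]] := set_0Vmem AA; first by rewrite cards0.
have CG : C \subset G := fintype.subset_trans (CA A0 A0A) (AG A0 A0A).
pose I := {A : {group gT} | A \in AA}.
have MA (i : I) : M (val i) \proper val i := maxgroupp (maxM _ (valP i)).
have MG (i : I) : M (val i) \subset G.
  exact: fintype.subset_trans (proper_sub (MA i)) (AG _ (valP i)).
pose vG : L := exist _ G (subxx G); pose vC : L := exist _ C CG.
pose v1 : L := exist _ 1%G (sub1G G).
pose vA (i : I) : L := exist _ (val i) (AG _ (valP i)).
pose vM (i : I) : L := exist _ (M (val i)) (MG i).
pose r (x : 'I_3) : L := if x == 0%R then vG else if x == 1%R then vC else v1.
(* Regions that contain the walks; the third one includes [vA i], where its walk ends. *)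
pose on (x : 'I_3) (i : I) (u : L) := if x == 0%R then val i \subset val u
  else if x == 1%R then (C \subset val u) && (val u \subset val i)
  else (val u \subset M (val i)) || (u == vA i).
have walk (x : 'I_3) i : exists w : seq L,
    [/\ path (@adj L) (r x) w, last (r x) w = vA i & forall u, u \in r x :: w -> on x i u].
  rewrite /r /on; case: (x == 0%R); last case: (x == 1%R).
  - have [w [pw lw inw]] := @subgroup_walk_down (vA i) vG (AG _ (valP i)).
    by exists w; split=> // u /inw /andP [].
  - have [w [pw lw inw]] := @subgroup_walk_up vC (vA i) (CA _ (valP i)).
    by exists w.
  - have [w [pw lw inw]] := @subgroup_walk_up v1 (vM i) (sub1G _).
    exists (rcons w (vA i)); split; rewrite ?last_rcons //.
      rewrite rcons_path pw lw /= /subgroup_adj.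
      by rewrite (@maximal_covered (vM i) (vA i)) ?maxM ?(valP i).
    move=> u; rewrite -rcons_cons mem_rcons in_cons orbC.
    by case/orP => [/inw /andP [_ ->]|->]; rewrite ?orbT.
have /choice [W HW] xi := walk xi.1 xi.2.
have sub_eq (i j : I) : val i \subset val j -> i = j.
  by move=> ij; apply/val_inj/anti => //; exact: valP.
(* A common vertex puts one member of the antichain inside another or, for the regions of [C] and of
   the trivial group, possibly [C] inside a chosen maximal subgroup. *)
have conflict (x y : 'I_3) i j u : (x < y)%N -> i != j -> on x i u -> on y j u -> False.
  move=> xy /eqP ij; have y0 : (y == 0%R) = false.
    by apply/eqP => y0; rewrite y0 in xy.
  rewrite /on y0; have [x0|x0] := eqVneq x 0%R.
    move=> iu; have [_ /andP [_ uj]|_] := eqVneq y 1%R.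
      exact/ij/sub_eq/(fintype.subset_trans iu).
    case/orP => [uM|/eqP uj]; apply/ij/sub_eq.
      exact: fintype.subset_trans iu (fintype.subset_trans uM (proper_sub (MA j))).
    by rewrite uj in iu.
  have x1 : x = 1%R.
    by apply/val_inj; move: x y x0 xy {y0} => [[|[|[|?]]] ?] [[|[|[|?]]] ?].
  have y1 : (y == 1%R) = false by apply/eqP => y1; rewrite x1 y1 in xy.
  rewrite x1 y1 eqxx => /andP [Cu ui] /orP [uM|/eqP uj].
    by move/negP: (CM _ (valP j)); apply; apply: fintype.subset_trans uM.
  by apply/ij/esym/sub_eq; rewrite uj in ui.
have -> : #|AA| = #|{: I}| by rewrite card_sig; apply: eq_card => A; rewrite !inE.
apply: (@embeds_K3n R g L I r vA (fun x i => W (x, i))) => //.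
- by move=> i j /(congr1 val) /= /val_inj.
- by move=> x i; have [] := HW (x, i).
- by move=> x i; have [] := HW (x, i).
move=> x y i j u xy ij ux; apply/negP => uy.
have [_ _ onx] := HW (x, i); have [_ _ ony] := HW (y, j).
move/onx: ux; move/ony: uy => /= uy ux.
have [lt_xy|lt_yx|/val_inj E] := ltngtP x y.
- exact: (conflict _ _ _ _ _ lt_xy ij ux uy).
- by apply: (conflict _ _ _ _ _ lt_yx _ uy ux); rewrite eq_sym.
- by rewrite E eqxx in xy.
Qed.

End SubgroupWalks.

(** * Bounds on irredundant sets, rank and antichains *)

Section Bounded.
Local Open Scope nat_scope.
Local Open Scope group_scope.
Variables (R : realType) (g : nat) (gT : finGroupType) (G : {group gT}).
Local Notation L := (subgroup_graph G).
Local Notation w := (2 * 64 ^ g)%N.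
Hypothesis emb : embeds R (@surface R g) L.

(** Fix [x0] in [A]. The groups [<<A :\ y>>] for the other [y] form an antichain of groups
    containing [x0], and each has a maximal subgroup that contains [A :\ y :\ x0], hence omits
    [x0]. *)
Lemma embeds_independent (A : {set gT}) : A \subset G ->
  (forall x, x \in A -> x \notin <<A :\ x>>) -> #|A| <= w.+1.
Proof.
move=> AG indep; have [->|[x0 x0A]] := set_0Vmem A; first by rewrite cards0.
pose B y : {group gT} := <<A :\ y>>%G.
have inB y z : z \in A -> z != y -> z \in B y.
  by move=> zA zy; apply: mem_gen; rewrite !inE zy.
have B_sub y z : y \in A -> z \in A -> B y \subset B z -> y = z.
  move=> yA zA /fintype.subsetP yz; apply/eqP; apply: contraNT (indep z zA) => nyz.
  by apply: yz; apply: inB => //; rewrite eq_sym.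
have cardB : #|[set B y | y in A :\ x0]| = #|A|.-1.
  rewrite card_in_imset ?(cardsD1 x0 A) ?x0A // => y z.
  rewrite !inE => /andP [_ yA] /andP [_ zA] E; apply: B_sub => //; by rewrite E.
have maxB y : y \in A :\ x0 -> exists M : {group gT}, maximal M (B y) && (x0 \notin M).
  rewrite !inE => /andP [yx0 yA].
  have sK : <<A :\ y :\ x0>> \subset B y by apply: genS; apply: subD1set.
  have [KB|[M maxM KM]] := @maximal_exists _ <<A :\ y :\ x0>>%G (B y) sK.
    case/negP: (indep x0 x0A); have : x0 \in B y by apply: inB; rewrite // eq_sym.
    by rewrite -KB; apply: (fintype.subsetP (genS (finset.setSD _ (finset.subD1set _ _)))).
  exists M; rewrite maxM; apply/negP => x0M.
  have /negP := proper_subn (maxgroupp maxM); apply.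
  rewrite gen_subG; apply/fintype.subsetP => z zAy; have [->//|zx0] := eqVneq z x0.
  by apply: (fintype.subsetP KM); apply: mem_gen; rewrite in_setD1 zx0.
pose M (H : {group gT}) : {group gT} :=
  odflt 1%G [pick M : {group gT} | maximal M H && (x0 \notin M)].
have MP y : y \in A :\ x0 -> maximal (M (B y)) (B y) && (x0 \notin M (B y)).
  move=> /maxB [K HK]; rewrite /M; case: pickP => [//|/(_ K)].
  by rewrite HK.
rewrite -(prednK (_ : 0 < #|A|)%N) ?ltnS; last by apply/card_gt0P; exists x0.
rewrite -cardB; apply: (@embeds_antichain _ _ R g <[x0]> _ M) emb.
- move=> _ _ /imsetP [y + ->] /imsetP [z + ->].
  by rewrite !inE => /andP [_ yA] /andP [_ zA] /(B_sub _ _ yA zA) ->.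
- move=> _ /imsetP [y _ ->]; rewrite gen_subG.
  exact: fintype.subset_trans (subD1set _ _) AG.
- move=> _ /imsetP [y + ->]; rewrite !inE cycle_subG => /andP [yx0 _].
  by apply: inB; rewrite // eq_sym.
- by move=> _ /imsetP [y /MP /andP [? _] ->].
- by move=> _ /imsetP [y /MP /andP [_ ?] ->]; rewrite cycle_subG.
Qed.

(** A generating set of least cardinality is irredundant. *)
Lemma embeds_rank : subgroup_rank G <= w.+1.
Proof.
rewrite /subgroup_rank; case: ex_minnP => r _; apply.
apply/forallP => H; apply/implyP => HG; apply/existsP.
have HH : <<H>> == H by rewrite genGid.
case: (@arg_minnP _ (gval H) (fun A : {set gT} => <<A>> == H) (fun A => #|A|) HH).
move=> A /eqP AH Amin.
exists A; rewrite AH eqxx andbT; apply: embeds_independent.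
  by apply: fintype.subset_trans HG; rewrite -AH subset_gen.
move=> x xA; apply/negP => xin.
have : <<A :\ x>> == H.
  rewrite -AH finset.eqEsubset genS ?subD1set //= gen_subG; apply/fintype.subsetP => y yA.
  have [->//|yx] := eqVneq y x; by apply: mem_gen; rewrite !inE yx.
by move/Amin; rewrite (cardsD1 x A) xA add1n ltnn.
Qed.

Lemma half_maximal (A M : {group gT}) : maximal M A -> #|A| <= 2 * #|A :\: M|.
Proof.
move=> /maxgroupp MA; have sMA := proper_sub MA.
have := Lagrange sMA; have : 1 < #|A : M| by rewrite indexg_gt1 proper_subn.
by rewrite cardsD (finset.setIidPr sMA); move: #|A : M|%g #|A| #|M| => i a m; nia.
Qed.

(* Counts the pairs [(x, A)] with [x] in [A] but not in a chosen maximal subgroup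
   of [A]; each [x] occurs at most [w] times by [embeds_antichain] for [<[x]>]. *)
Lemma antichain_weight (AA : {set {group gT}}) :
  (forall A B, A \in AA -> B \in AA -> A \subset B -> A = B) ->
  (forall A, A \in AA -> A \subset G) -> 1%G \notin AA ->
  \sum_(A in AA) #|A| <= 2 * w * #|G|.
Proof.
move=> anti AG n1.
have /fin_all_exists [M maxM] (A : {group gT}) :
    exists M : {group gT}, A \in AA -> maximal M A.
  have [AA1|] := boolP (A \in AA); last by exists 1%G.
  have [E|[M ? _]] := maximal_exists (sub1G A); last by exists M.
  by case/negP: n1; rewrite (_ : 1%G = A) //; apply: group_inj.
have card_x x : #|[set A in AA | x \in A :\: M A]| <= w.
  apply: (@embeds_antichain _ _ R g <[x]> _ M) emb => [A B|A|A|A|A];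
    rewrite !inE ?cycle_subG => /andP [AAA /andP [xM xA]] //.
  - by move=> /andP [? _]; apply: anti.
  - exact: AG.
  - exact: maxM.
apply: (@leq_trans (2 * \sum_(A in AA) #|A :\: M A|)).
  by rewrite big_distrr; apply: leq_sum => A /maxM /half_maximal.
rewrite -mulnA leq_mul2l /=.
have -> : \sum_(A in AA) #|A :\: M A| = \sum_(x in G) #|[set A in AA | x \in A :\: M A]|.
  under eq_bigr do rewrite -sum1_card.
  under [RHS]eq_bigr do rewrite -sum1_card.
  rewrite (exchange_big_dep (mem G)) /=.
    by apply: eq_bigr => x xG; apply: eq_bigl => A; rewrite !inE.
  by move=> A x /AG /fintype.subsetP AGx; rewrite inE => /andP [_ /AGx].
by rewrite mulnC -sum_nat_const; apply: leq_sum.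
Qed.

End Bounded.

(** * Sylow normalizers and the number of primes *)

Section SylowNormalizers.
Local Open Scope nat_scope.
Local Open Scope group_scope.
Variables (gT : finGroupType) (G : {group gT}).
(* ['N_G(P)] would be parsed as the notation of an L^p norm. *)
Local Notation NG P := (G :&: 'N(P)).

(** [P] is the [p]-core of its normalizer, hence characteristic in it: whatever normalizes the
    normalizer also normalizes [P]. *)
Lemma Sylow_norm_self p (P : {group gT}) : p.-Sylow(G) P -> NG (NG P) = NG P.
Proof.
move=> sylP; apply/eqP; rewrite finset.eqEsubset finset.subsetI finset.subsetIl /=.
have PG := pHall_sub sylP.
have sylN : p.-Sylow(NG P) P.
  by apply: pHall_subl sylP; rewrite ?finset.subsetIl // finset.subsetI PG normG.
rewrite -{2}(normal_Hall_pcore sylN (normalSG PG)).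
rewrite (fintype.subset_trans (finset.subsetIr _ _)) ?gFnorms //=.
by rewrite finset.subsetI finset.subsetIl normG.
Qed.

Lemma Sylow_normJ p (P : {group gT}) x : x \in G -> p.-Sylow(G) P ->
  p.-Sylow(G) (P :^ x) /\ NG (P :^ x) = NG P :^ x.
Proof.
by move=> xG sylP; rewrite pHallJ // conjIg normJ conjGid.
Qed.

End SylowNormalizers.

Section SylowSteps.
Local Open Scope nat_scope.
Local Open Scope group_scope.
Variables (R : realType) (g : nat) (gT : finGroupType) (G : {group gT}).
Local Notation L := (subgroup_graph G).
Local Notation w := (2 * 64 ^ g)%N.
Local Notation NG P := (G :&: 'N(P)).
Hypothesis emb : embeds R (@surface R g) L.

Definition above_Sylow_norm p (A : {set gT}) :=
  [exists P : {group gT}, p.-Sylow(G) P && (NG P \subset A)].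

(** Averaging over the maximal Sylow normalizers [A] with weight [#|A|]: each prime of [D] accounts
    for at least [#|G|], out of a total of at most [2 * w * #|G|]. *)
Lemma Sylow_norm_majority (D : seq nat) : D != [::] ->
  (forall p, p \in D -> p \in primes #|G|) ->
  exists p0 (Q : {group gT}), [/\ p0 \in D, p0.-Sylow(G) Q &
    size D <= 2 * w * count (above_Sylow_norm^~ (NG Q)) D].
Proof.
move=> D0 Dprimes.
pose SS := [set A : {group gT} | has (fun p =>
  [exists P : {group gT}, p.-Sylow(G) P && (gval A == NG P)]) D].
have SSP A : A \in SS ->
    exists p (P : {group gT}), [/\ p \in D, p.-Sylow(G) P & gval A = NG P].
  rewrite inE => /hasP [p pD /existsP [P /andP [sylP /eqP AP]]].
  by exists p, P.
have inSS p (P : {group gT}) : p \in D -> p.-Sylow(G) P -> [group of NG P] \in SS.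
  move=> pD sylP; rewrite inE; apply/hasP; exists p => //.
  by apply/existsP; exists P; rewrite sylP /=.
have SSG A : A \in SS -> A \subset G.
  by move=> /SSP [p [P [_ _ ->]]]; apply: finset.subsetIl.
have SSJ A x : x \in G -> A \in SS -> (A :^ x)%G \in SS.
  move=> xG /SSP [p [P [pD sylP AP]]]; have [sylPx NPx] := Sylow_normJ xG sylP.
  have -> : (A :^ x)%G = [group of NG (P :^ x)%G] by apply/group_inj; rewrite /= NPx AP.
  exact: inSS sylPx.
pose AA := [set A in SS | [forall B in SS, (A \subset B) ==> (A == B)]].
have AAP A : A \in AA -> A \in SS /\ forall B, B \in SS -> A \subset B -> A = B.
  rewrite !inE => /andP [? /forall_inP h]; split=> // B BS AB.
  by apply/eqP; apply: (implyP (h B BS)).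
have AAI A : A \in SS -> (forall B, B \in SS -> A \subset B -> A = B) -> A \in AA.
  move=> AS h; rewrite inE AS; apply/forall_inP => B BS; apply/implyP => AB.
  exact/eqP/h.
have above A : A \in SS -> exists2 B, B \in AA & A \subset B.
  move=> AS; have AAS : (A \in SS) && (A \subset A) by rewrite AS subxx.
  case: (@arg_maxnP _ A (fun B : {group gT} => (B \in SS) && (A \subset B))
    (fun B => #|B|) AAS).
  move=> B /andP [BS AB] Bmax; exists B => //; apply: AAI => // B' BS' BB'.
  apply/group_inj/eqP; rewrite eqEcard BB'; apply: Bmax.
  by rewrite BS'; apply: fintype.subset_trans BB'.
have AAJ A x : x \in G -> A \in AA -> (A :^ x)%G \in AA.
  move=> xG /AAP [AS Amax]; apply: AAI; first exact: SSJ.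
  move=> B BS AB; have := Amax (B :^ x^-1)%G; rewrite SSJ ?groupV // => /(_ isT).
  rewrite /= -sub_conjg AB => /(_ isT) ->; apply: group_inj => /=.
  by rewrite conjsgKV.
have normA A : A \in AA -> NG A = A.
  by move=> /AAP [/SSP [p [P [_ sylP ->]]] _]; apply: (Sylow_norm_self sylP).
have n1 : 1%G \notin AA.
  apply/negP => /AAP [/SSP [p [P [pD sylP P1]]] _].
  have /trivgP P1' : P \subset 1%G by rewrite /= P1 finset.subsetI (pHall_sub sylP) normG.
  have := p_part_gt1 p #|G|; rewrite -(card_Hall sylP) P1' cards1 ltnn.
  by move/esym; rewrite [_ \in _](Dprimes p pD).
have weight := antichain_weight emb (fun A B AAA BAA => (AAP A AAA).2 B (AAP B BAA).1)
  (fun A AAA => SSG A (AAP A AAA).1) n1.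
(* A maximal [A] is self-normalizing, so its conjugates have total weight [#|G|]; each contains the
   normalizer of a [p]-Sylow subgroup as soon as [A] does. *)
have orbit_weight p : p \in D -> #|G| <= \sum_(A in AA | above_Sylow_norm p A) #|A|.
  move=> pD; have [P sylP] := Sylow_exists p G.
  have [A AAA PA] := above _ (inSS p P pD sylP).
  pose O := [set (A :^ x)%G | x in G].
  have cardO : (#|O| * #|A| = #|G|)%N.
    have <- : #|A :^: G| = #|O|.
      by rewrite -(card_imset O (@group_inj _)) /O -imset_comp.
    rewrite card_conjugates (normA A AAA) mulnC Lagrange //.
    by apply: SSG; case: (AAP A AAA).
  rewrite -cardO -sum_nat_const.
  have -> : \sum_(i in O) #|A| = \sum_(i in O) #|i|.
    by apply: eq_bigr => _ /imsetP [x _ ->]; rewrite cardJg.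
  rewrite [leqLHS]big_mkcond [leqRHS]big_mkcond /=; apply: leq_sum => B _.
  case: (boolP (B \in O)) => // BO.
  case/imsetP: BO => x xG ->; rewrite AAJ //=.
  suff -> : above_Sylow_norm p (A :^ x) by [].
  have [sylPx NPx] := Sylow_normJ xG sylP.
  by apply/existsP; exists (P :^ x)%G; rewrite sylPx NPx conjSg.
have wpos : (0 < 2 * w)%N by rewrite !muln_gt0 expn_gt0.
have [A AAA majority] : exists2 A, A \in AA &
    (size D <= 2 * w * count (above_Sylow_norm^~ A) D)%N.
  (* If every [2 * w * count] were at most [(size D).-1], the weighted number of pairs of an [A] and
     a prime would be too small. *)
  apply/exists_inP; apply: contraT => /exists_inPn few.
  have : (2 * w * (#|G| * size D) <=
          2 * w * \sum_(A in AA) (#|A| * count (above_Sylow_norm^~ A) D))%N.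
    rewrite leq_mul2l; apply/orP; right.
    under [leqRHS]eq_bigr do rewrite -sum1_count big_distrr /=.
    rewrite (exchange_big_dep predT) //= mulnC -sum1_size big_distrl /=.
    rewrite big_seq [leqRHS]big_seq; apply: leq_sum => p pD; rewrite mul1n.
    by under eq_bigr do rewrite muln1; apply: orbit_weight.
  apply/contraTT => _; rewrite -ltnNge.
  apply: (@leq_ltn_trans (\sum_(A in AA) #|A| * (size D).-1)).
    rewrite big_distrr; apply: leq_sum => A AAA /=.
    rewrite mulnCA leq_mul2l; apply/orP; right.
    by have := few A AAA; rewrite -ltnNge; case: (size D).
  rewrite -big_distrl /= -size_eq0 in D0 *.
  have := cardG_gt0 G; move: weight wpos D0.
  move: (\sum_(A in AA) #|A|) (2 * w)%N #|G| (size D) => s W n m h1 h2 h3 h4.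
  apply: (@leq_ltn_trans (W * n * m.-1)); first by rewrite leq_mul2r h1 orbT.
  by rewrite mulnA ltn_pmul2l ?muln_gt0 ?h2 //; case: m h3.
have [p [Q [pD sylQ AQ]]] := SSP A (AAP A AAA).1.
by exists p, Q; rewrite -AQ.
Qed.

(** A step keeps at least one prime in [2 * w] and then discards the prime just used, whence the
    successor. *)
Fixpoint chain_bound l := if l is l'.+1 then (2 * w * (chain_bound l').+1)%N else 0%N.

Lemma Sylow_norm_chain l (D : seq nat) : chain_bound l <= size D -> uniq D ->
  (forall p, p \in D -> p \in primes #|G|) ->
  exists (ps : seq nat) (Q : nat -> {group gT}), [/\ size ps = l, uniq ps,
    {subset ps <= D}, forall p, p \in ps -> p.-Sylow(G) (Q p) &
    sorted (fun p q => NG (Q q) \subset NG (Q p)) ps].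
Proof.
elim: l D => [|l IHl] D /= sizeD uD Dprimes; first by exists [::], (fun=> 1%G).
have D0 : D != [::].
  by rewrite -size_eq0 -lt0n (leq_trans _ sizeD) // !muln_gt0 expn_gt0.
have [p0 [Q0 [p0D sylQ0 major]]] := Sylow_norm_majority D0 Dprimes.
pose D1 := [seq p <- rem p0 D | above_Sylow_norm p (NG Q0)].
have sD1 : {subset D1 <= D} by move=> p; rewrite mem_filter => /andP [_ /mem_rem].
have [|||ps [Q [sz_ps ups psD1 sylQ sortQ]]] := IHl D1.
- have : (chain_bound l < count (above_Sylow_norm^~ (NG Q0)) D)%N.
    rewrite -(@ltn_pmul2l (2 * w)) ?muln_gt0 ?expn_gt0 //.
    have := leq_trans sizeD major; rewrite leq_pmul2l ?muln_gt0 ?expn_gt0 // => h.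
    by rewrite ltn_pmul2l ?muln_gt0 ?expn_gt0.
  move=> h; rewrite size_filter -ltnS; apply: leq_trans h _.
  have /seq.permP/(_ (above_Sylow_norm^~ (NG Q0))) -> := perm_to_rem p0D.
  by rewrite /=; case: above_Sylow_norm.
- by rewrite filter_uniq // rem_uniq.
- by move=> p /sD1 /Dprimes.
have p0ps : p0 \notin ps.
  by apply/negP => /psD1; rewrite mem_filter mem_rem_uniqF ?andbF.
(* The chain for [ps] is already fixed, so [Q0] is the one to be conjugated: [x] carries the Sylow
   subgroup whose normalizer lies below that of [Q0] to the head of the chain. *)
have [x xG nest] : exists2 x, x \in G &
    forall q, ohead ps = Some q -> NG (Q q) \subset NG (Q0 :^ x).
  case: ps psD1 sylQ {sz_ps ups sortQ p0ps} => [|q ps] psD1 sylQ; first by exists 1.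
  have := psD1 q (mem_head _ _); rewrite mem_filter.
  move=> /andP [/existsP [P /andP [sylP PQ0]] _].
  have [x xG QP] := Sylow_trans sylP (sylQ q (mem_head _ _)).
  exists x => // _ [<-]; rewrite QP (Sylow_normJ xG sylP).2 (Sylow_normJ xG sylQ0).2.
  by rewrite conjSg.
pose Q' p := if p == p0 then (Q0 :^ x)%G else Q p.
have Q'E p : p \in ps -> Q' p = Q p.
  by move=> pps; rewrite /Q' ifN //; apply: contraNneq p0ps => <-.
have Q'0 : Q' p0 = (Q0 :^ x)%G by rewrite /Q' eqxx.
exists (p0 :: ps), Q'; split => [||p|p|].
- by rewrite /= sz_ps.
- by rewrite /= p0ps.
- by rewrite inE => /predU1P [-> //|/psD1/sD1].
- rewrite inE => /predU1P [->|pps]; last by rewrite Q'E //; apply: sylQ.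
  by rewrite Q'0; case: (Sylow_normJ xG sylQ0).
- case: ps nest sortQ Q'E {sz_ps ups psD1 sylQ p0ps} => [//|q ps] nest sortQ Q'E.
  rewrite /= Q'0 Q'E ?mem_head // nest //=.
  rewrite -(@eq_in_path _ (mem (q :: ps)) (fun p q => NG (Q q) \subset NG (Q p))) //.
    by move=> a b aps bps /=; rewrite !Q'E.
  by apply/allP => z.
Qed.

End SylowSteps.

Section SylowTower.
Local Open Scope nat_scope.
Local Open Scope group_scope.
Variables (R : realType) (g : nat) (gT : finGroupType) (G : {group gT}).
Local Notation L := (subgroup_graph G).
Local Notation w := (2 * 64 ^ g)%N.
Local Notation NG P := (G :&: 'N(P)).

(** The later groups normalize the first one, so their join with it is a product of two [pi]-groups,
    by induction. *)
Lemma pgroup_normal_chain (pi : nat_pred) (ps : seq nat) (Q : nat -> {group gT}) :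
  pairwise (fun p q => Q q \subset 'N(Q p)) ps ->
  (forall p, p \in ps -> pi.-group (Q p)) ->
  pi.-group <<\bigcup_(p <- ps) Q p>>.
Proof.
elim: ps => [|p ps IHps] /=; first by rewrite big_nil gen0 pgroup1.
move=> /andP [/allP pN pw] piQ.
rewrite big_cons -joingE -joing_idr norm_joinEr; last first.
  rewrite gen_subG big_seq.
  apply: (big_ind (fun X : {set gT} => X \subset _)) => [|X Y XN YN|].
  - exact: finset.sub0set.
  - by rewrite finset.subUset XN.
  - exact: pN.
by rewrite pgroupM piQ ?mem_head //= IHps // => q qps; rewrite piQ // in_cons qps orbT.
Qed.

Hypothesis emb : embeds R (@surface R g) L.

(** Choose an element of order [p] in each [Q p]. The other chosen elements lie in the join of the
    other groups, a [p^']-group, which contains no element of order [p]. *)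
Lemma embeds_Sylow_chain (ps : seq nat) (Q : nat -> {group gT}) :
  uniq ps -> (forall p, p \in ps -> p \in primes #|G|) ->
  (forall p, p \in ps -> p.-Sylow(G) (Q p)) ->
  sorted (fun p q => NG (Q q) \subset NG (Q p)) ps -> size ps <= w.+1.
Proof.
move=> ups psG sylQ sortQ.
have pr p : p \in ps -> prime p by move=> /psG; rewrite mem_primes => /andP [].
have /choice [x Hx] p : exists x, p \in ps -> x \in Q p /\ #[x] = p.
  have [pps|] := boolP (p \in ps); last by exists 1.
  have pQ : p %| #|Q p|.
    rewrite (card_Hall (sylQ p pps)) -[X in X %| _]expn1 pfactor_dvdn ?pr ?part_gt0 //.
    rewrite logn_part -pfactor_dvdn ?pr // expn1.
    by have := psG p pps; rewrite mem_primes => /and3P [].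
  by have [y yQ oy] := Cauchy (pr p pps) pQ; exists y.
have trQ : transitive (fun p q => NG (Q q) \subset NG (Q p)).
  by move=> q p r pq qr; apply: fintype.subset_trans qr pq.
have pwQ : pairwise (fun p q => Q q \subset 'N(Q p)) ps.
  have := sortQ; rewrite (sorted_pairwise trQ).
  apply: (@sub_in_pairwise _ (mem ps)) (allss ps) => p q pps qps.
  move=> h; apply: fintype.subset_trans (finset.subsetIr G _).
  by apply: fintype.subset_trans h; rewrite finset.subsetI (pHall_sub (sylQ q qps)) normG.
have uxs : uniq (map x ps).
  rewrite map_inj_in_uniq // => p q /Hx [_ xp] /Hx [_ xq] xpq.
  by rewrite -xp xpq xq.
have -> : size ps = #|[set:: map x ps]| by rewrite cardsE (card_uniqP uxs) size_map.
apply: (embeds_independent emb).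
  apply/fintype.subsetP => y; rewrite inE => /mapP [p pps ->].
  by apply: (fintype.subsetP (pHall_sub (sylQ p pps))); case: (Hx p pps).
move=> y; rewrite inE => /mapP [p pps ->]; apply/negP => xin.
pose K := <<\bigcup_(q <- [seq q <- ps | q != p]) Q q>>.
have p'K : p^'.-group K.
  apply: pgroup_normal_chain; first by rewrite pairwise_filter.
  move=> q; rewrite mem_filter => /andP [qp qps].
  apply: sub_in_pnat (pHall_pgroup (sylQ q qps)) => r _.
  by rewrite !inE => /eqP ->.
have xK : x p \in K.
  apply: (fintype.subsetP _ _ xin); apply: genS; apply/fintype.subsetP => z.
  rewrite !inE => /andP [zp /mapP [q qps zq]]; rewrite zq in zp *.
  have qp : q != p by apply: contraNneq zp => ->.
  have sQ : Q q \subset \bigcup_(q <- [seq q <- ps | q != p]) Q q.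
    by rewrite (big_rem q) ?mem_filter ?qp //= finset.subsetUl.
  by apply: (fintype.subsetP sQ); case: (Hx q qps).
have := pnat_dvd (order_dvdG xK) p'K; rewrite (Hx p pps).2.
by rewrite p'natE ?pr // dvdnn.
Qed.

Lemma embeds_primes : size (primes #|G|) < chain_bound g w.+2.
Proof.
rewrite ltnNge; apply/negP => many.
have [ps [Q [szps ups psD sylQ sortQ]]] :=
  Sylow_norm_chain emb many (primes_uniq _) (fun _ => id).
by have := embeds_Sylow_chain ups psD sylQ sortQ; rewrite szps ltnn.
Qed.

End SylowTower.

Lemma chain_bound_mono g k l : (g <= k)%N -> (chain_bound g l <= chain_bound k l)%N.
Proof.
move=> gk; elim: l => //= l IHl.
by rewrite leq_mul // leq_mul2l /= leq_mul2l /= leq_exp2l.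
Qed.

Lemma chain_bound_leq g l m : (l <= m)%N -> (chain_bound g l <= chain_bound g m)%N.
Proof.
elim: m l => [|m IHm] [|l] //= lm; rewrite leq_mul2l ltnS; apply/orP; right.
exact: IHm.
Qed.

Theorem theorem1 (R : realType) (k : nat) :
  exists N : nat, forall (gT : finGroupType) (G : {group gT}),
    (N <= subgroup_rank G)%N \/ (N <= size (primes #|G|))%N ->
    (k%:R%:E < genus R (subgroup_graph G))%E.
Proof.
pose w := (2 * 64 ^ k)%N.
(* Ranks and lengths of Sylow chains are at most [w.+1], hence [w.+2] in both places. *)
exists (maxn w.+2 (chain_bound k w.+2)) => gT G large.
(* The genus is an infimum: excluding every [g <= k] bounds it below by [k.+1]. *)
apply: (@lt_le_trans _ _ k.+1%:R%:E); first by rewrite lte_fin ltr_nat.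
apply: le_ereal_inf_tmp => _ [g emb <-]; rewrite lee_fin ler_nat ltnNge.
apply/negP => gk; have wgw : (2 * 64 ^ g <= w)%N by rewrite leq_mul2l leq_exp2l.
case: large; rewrite geq_max => /andP [h1 h2].
  by have := leq_trans h1 (embeds_rank emb); rewrite ltnS ltnNge wgw.
have := embeds_primes emb; rewrite ltnNge => /negP; apply.
apply: leq_trans h2; apply: leq_trans (chain_bound_mono _ gk) _.
by apply: chain_bound_leq; rewrite !ltnS.
Qed.
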